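(* Let $\alpha>0$ be a real number, let $\varphi$ be a real-valued $C^\infty$ function on an open interval of $\mathbb{R}$ containing $0$ whose support is compact and contained in this interval (so $\varphi$ is extended by $0$ to $\mathbb{R}$). For $t\in\mathbb{R}$ set $$I_\alpha(t)=\int_0^\infty \exp\!\left(i t\,\frac{1}{x^\alpha}\right)\varphi(x)\,dx,\qquad \tilde I_\alpha(t)=I_\alpha(t)-\int_0^\infty\varphi(x)\,dx .$$ (1) If $0<\alpha<1$, then $$\lim_{t\to 0}\frac{\tilde I_\alpha(t)}{t}=i\int_0^\infty\frac{\varphi(x)}{x^\alpha}\,dx.$$ (2) If $\alpha=1$, then $$\lim_{t\to +0}\frac{\tilde I_\alpha(t)}{t\log t}=-i\,\varphi(0).$$ (3) If $\alpha>1$, then $$\lim_{t\to+0}\frac{\tilde I_\alpha(t)}{t^{1/\alpha}}=\frac{1}{\alpha}\,\varphi(0)\,e^{-\frac{1}{2\alpha}\pi i}\,\Gamma\!\left(-\frac1\alpha\right).$$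
   Context: $\Gamma$ is the Gamma function (meromorphically continued). $t\to+0$ means that $t$ tends to $0$ through positive values. *)

(* Defs.v *)
From HB Require Import structures.
From mathcomp Require Import all_boot all_order all_algebra.
From mathcomp Require Import complex.
From mathcomp Require Import all_classical all_reals all_analysis.

Set Implicit Arguments.
Unset Strict Implicit.
Unset Printing Implicit Defensive.

Import Order.TTheory GRing.Theory Num.Theory.
Import numFieldNormedType.Exports.

Local Open Scope classical_set_scope.
Local Open Scope complex_scope.
Local Open Scope ring_scope.

Section ComplexFunctions.
Context {R : realType}.

Definition cexp (z : R[i]) : R[i] :=
  (expR (complex.Re z))%:C * (cos (complex.Im z) +i* sin (complex.Im z)).

Definition cintegral (A : set R) (f : R -> R[i]) : R[i] :=
  (\int[lebesgue_measure]_(x in A) complex.Re (f x))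
  +i* (\int[lebesgue_measure]_(x in A) complex.Im (f x)).

(* Euler's integral, meaningful for 0 < Re z; x ^ (z - 1) is
   exp ((z - 1) log x). *)
Definition Gamma_integral (z : R[i]) : R[i] :=
  cintegral `]0, +oo[ (fun x => cexp ((z - 1) * (ln x)%:C) * (expR (- x))%:C).

(* Number of unit shifts to the right needed to enter the half-plane
   0 < Re z; [Num.truncn] is the floor here. *)
Definition Gamma_shift (z : R[i]) : nat :=
  if 0 < complex.Re z then 0%N else (Num.truncn (- complex.Re z)).+1.

(* Meromorphic continuation of Euler's integral by the functional equation
   Gamma (z + 1) = z * Gamma z.  At the poles z = 0, -1, -2, ... a factor of
   the product vanishes and the value is the conventional 0. *)
Definition Gamma (z : R[i]) : R[i] :=
  Gamma_integral (z + (Gamma_shift z)%:R)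
  / \prod_(k < Gamma_shift z) (z + k%:R).

End ComplexFunctions.

Section Problem.
Context {R : realType}.

Definition smooth_on (U : set R) (f : R -> R) : Prop :=
  forall (n : nat) (x : R), U x -> derivable (f^`(n)%classic) x 1.

Definition tsupport (f : R -> R) : set R := closure [set x | f x != 0].

Definition I_osc (alpha : R) (phi : R -> R) (t : R) : R[i] :=
  cintegral `]0, +oo[
    (fun x => cexp ('i%C * t%:C * (1 / x `^ alpha)%:C) * (phi x)%:C).

Definition I_tilde (alpha : R) (phi : R -> R) (t : R) : R[i] :=
  I_osc alpha phi t
  - (\int[lebesgue_measure]_(x in `]0, +oo[) phi x)%:C.

End Problem.

(* Main.v *)
(* After taking real and imaginary parts, write c for cos - 1 or sin.
   (1) For alpha < 1, divide by t and use dominated convergence.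
   (3) For alpha > 1, the substitution t / x^alpha = u gives
   t^(1/alpha) / alpha times the integral of
   c(u) u^(s - 1) phi(t^(1/alpha) u^s) with s = - 1/alpha, so dominated
   convergence leaves the integral of (e^(i u) - 1) u^(s - 1), -1 < s < 0.
   To evaluate it without contour integration, let g(th) be the integral of
   (e^(- lambda u) - 1) u^(s - 1) along lambda = e^(- i th).  Differentiating
   under the integral and integrating by parts gives g' = i s g on
   ]-pi/2, pi/2[, while integration by parts at th = 0 gives
   s g(0) = Gamma(s + 1); the value e^(i s pi/2) g(0) at th = pi/2 follows by
   dominated convergence.
   (2) For alpha = 1, the real part is O(t), and replacing sin (t / x) by a
   rational kernel with explicit integral - t ln t costs only O(t). *)
Require Import Defs.
From HB Require Import structures.
From mathcomp Require Import all_boot all_order all_algebra.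
From mathcomp Require Import complex.
From mathcomp Require Import all_classical all_reals all_analysis measurable_realfun.
From mathcomp Require Import ring lra.

Import Order.TTheory GRing.Theory Num.Theory.
Import numFieldNormedType.Exports.

Local Open Scope classical_set_scope.
Local Open Scope complex_scope.
Local Open Scope ring_scope.

Set Implicit Arguments.
Unset Strict Implicit.
Unset Printing Implicit Defensive.

(** The range of absolute convergence shapes the proof. One majorant, u^(s - 1) min(u, 1), serves
    parts (1) and (3) and the evaluation of the Gamma factor; it is integrable for -1 < s < 0 and is
    taken at s = - alpha and at s = - 1/alpha. The 1 subtracted from e^(i u) makes the integral
    converge at 0, and it also encodes the continuation of Gamma: g(0) = Gamma(s + 1) / s =
    Gamma(s). At alpha = 1 the exponent s = -1 leaves the range, and the divergence of the integral
    of phi(x) / x at 0 is the source of the logarithm. Each basic integrability statement on the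
    half-line comes from an explicit bounded primitive, an arctangent or, at alpha = 1, a logarithm;
    the others follow by domination. Dominated convergence acts on sequences, so limits in a real
    parameter are tested along sequences. *)

Section RealIntegrable.
Context d (T : measurableType d) (R : realType).
Variable (mu : {measure set T -> \bar R}) (D : set T).
Hypothesis mD : measurable D.
Implicit Types (f g : T -> R).

Lemma le_Rintegrable f g :
  measurable_fun D f -> (forall x, D x -> `|f x| <= g x) ->
  mu.-integrable D (EFin \o g) -> mu.-integrable D (EFin \o f).
Proof.
move=> mf fg; apply: le_integrable => //; first exact/measurable_EFinP.
by move=> x Dx; rewrite lee_fin (le_trans (fg _ Dx)) ?ler_norm.
Qed.

Lemma RintegrableZl (c : R) f :
  mu.-integrable D (EFin \o f) -> mu.-integrable D (EFin \o (fun x => c * f x)).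
Proof.
move=> fi; have := integrableZl mD c fi.
by apply: eq_integrable => // x _; rewrite /= EFinM.
Qed.

Lemma RintegrableD f g :
  mu.-integrable D (EFin \o f) -> mu.-integrable D (EFin \o g) ->
  mu.-integrable D (EFin \o (fun x => f x + g x)).
Proof.
move=> fi gi; have := integrableD mD fi gi.
by apply: eq_integrable => // x _; rewrite /= EFinD.
Qed.

(** Convergence at every point of [D] makes the limit measurable, and domination makes its integral
    finite, which allows passing from extended reals to reals. *)
Lemma cvg_Rintegral_dominated (f_ : nat -> T -> R) f g :
  (forall n, measurable_fun D (f_ n)) ->
  (forall x, D x -> f_ n x @[n --> \oo] --> f x) ->
  mu.-integrable D (EFin \o g) ->
  (forall n x, D x -> `|f_ n x| <= g x) ->
  \int[mu]_(x in D) f_ n x @[n --> \oo] --> \int[mu]_(x in D) f x.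
Proof.
move=> mf ff ig fg.
have mfE n : measurable_fun D (EFin \o f_ n) by apply/measurable_EFinP.
have ffE x : D x -> (f_ n x)%:E @[n --> \oo] --> (f x)%:E.
  by move=> Dx; apply: cvg_EFin; [exact: nearW|exact: ff].
have mfl : measurable_fun D (EFin \o f) by exact: emeasurable_fun_cvg mfE ffE.
have [fi _ h] := @dominated_convergence _ T R mu D mD
  (fun n => EFin \o f_ n) (EFin \o f) (EFin \o g) mfE mfl (aeW _ ffE) ig
  (aeW _ (fun x n Dx => fg n x Dx)).
apply: fine_cvg; rewrite fineK//.
exact: integrable_fin_num.
Qed.

End RealIntegrable.

(** * Integrability on the half-line from a bounded primitive *)

Section HalfLine.
Variable R : realType.
Local Notation mu := (@lebesgue_measure R).
Local Notation HL := (`]0%R, +oo[%classic : set R).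
Implicit Types (f F G : R -> R) (a b x : R).

Lemma HL_gt0 x : HL x -> 0 < x.
Proof. by rewrite /= in_itv/= andbT. Qed.

Lemma ftc_gt0 f F a b : 0 < a -> a <= b ->
  (forall x, 0 < x -> {for x, continuous f}) ->
  (forall x, 0 < x -> is_derive x 1 F (f x)) ->
  (\int[mu]_(x in `[a, b]) (f x)%:E = (F b - F a)%:E)%E.
Proof.
move=> a0; rewrite le_eqVlt => /predU1P[<- _ _|ab cf dF].
  by rewrite set_itv1 integral_set1 subrr.
have pos x : a <= x -> 0 < x by exact: lt_le_trans.
have cF x : 0 < x -> {for x, continuous F}.
  move=> /dF [dFx _].
  exact/differentiable_continuous/derivable1_diffP.
rewrite EFinB; apply: continuous_FTC2 => //.
- apply/continuous_within_itvP => //; split.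
  + by move=> x; rewrite in_itv/= => /andP[/ltW/pos/cf].
  + exact/cvg_at_right_filter/cf.
  + exact/cvg_at_left_filter/cf/pos/ltW.
- split.
  + by move=> x; rewrite in_itv/= => /andP[/ltW/pos/dF[]].
  + exact/cvg_at_right_filter/cF.
  + exact/cvg_at_left_filter/cF/pos/ltW.
- by move=> x; rewrite in_itv/= => /andP[/ltW/pos/dF[? <-] _]; rewrite derive1E.
Qed.

Lemma measurable_oy f : (forall x, 0 < x -> {for x, continuous f}) ->
  measurable_fun (`]0, +oo[ : set R) f.
Proof.
move=> cf; apply: open_continuous_measurable_fun; first exact: interval_open.
by move=> x; rewrite inE/= in_itv/= andbT => /cf.
Qed.

Lemma itv_oy_bigcup : `]0, +oo[%classic =
  \bigcup_n `[n.+1%:R^-1, n.+1%:R]%classic :> set R.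
Proof.
apply/seteqP; split => x /=; rewrite in_itv/= ?andbT.
  (* The successor of this index exceeds both x and 1/x; inverting the second bound gives the lower
     end of the interval. *)
  move=> x0; exists (maxn (Num.truncn x^-1) (Num.truncn x)) => //=.
  have h (y : R) : (Num.truncn y <= maxn (Num.truncn x^-1) (Num.truncn x))%N ->
      y <= (maxn (Num.truncn x^-1) (Num.truncn x)).+1%:R.
    by move=> yn; apply/ltW/(lt_le_trans (truncnS_gt y)); rewrite ler_nat.
  rewrite in_itv/= h ?leq_maxr// andbT -[leRHS]invrK lef_pV2 ?posrE ?invr_gt0//.
  by rewrite h// leq_maxl.
by move=> [n _ /=]; rewrite in_itv/= => /andP[+ _]; apply: lt_le_trans.
Qed.

Lemma nondecreasing_itv_oy :
  {homo (fun n => `[n.+1%:R^-1, n.+1%:R]%classic : set R) :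
    n m / (n <= m)%N >-> (n <= m)%O}.
Proof.
move=> n m nm; apply/subsetPset => x /=; rewrite !in_itv/= => /andP[nx xn].
rewrite (le_trans _ nx) ?lef_pV2 ?posrE ?ler_nat//=.
by rewrite (le_trans xn)// ler_nat.
Qed.

(** Each integral over [1/(n+1), n+1] is a difference of two values of [F], hence at most 2B; as [f]
    is nonnegative, monotone convergence carries this bound to the half-line. *)
Lemma integrable_oy f F (B : R) :
  (forall x, 0 < x -> 0 <= f x) ->
  (forall x, 0 < x -> {for x, continuous f}) ->
  (forall x, 0 < x -> is_derive x 1 F (f x)) ->
  (forall x, 0 < x -> `|F x| <= B) ->
  mu.-integrable `]0, +oo[ (EFin \o f).
Proof.
move=> f0 cf dF FB.
have mf : measurable_fun HL (EFin \o f).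
  by apply/measurable_EFinP; exact: measurable_oy.
apply/integrableP; split => //.
have -> : (\int[mu]_(x in HL) `|(EFin \o f) x| = \int[mu]_(x in HL) (EFin \o f) x)%E.
  apply: eq_integral => x; rewrite inE/= in_itv/= andbT => x0.
  by rewrite ger0_norm// f0.
apply: (@le_lt_trans _ _ (B + B)%:E); last by rewrite ltry.
have Ipos n x : `[n.+1%:R^-1, n.+1%:R]%classic x -> 0 < x.
  by rewrite /= in_itv/= => /andP[+ _]; apply: lt_le_trans.
have cvgI := @ge0_nondecreasing_set_cvg_integral _ (measurableTypeR R) R _
  (EFin \o f) mu nondecreasing_itv_oy (fun i => measurable_itv _).
rewrite -itv_oy_bigcup in cvgI.
apply: (cvge_to_le (cvgI _ _)).
- by move=> i; apply: measurable_funS mf => // x /Ipos x0; rewrite /= in_itv/= x0.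
- by move=> i x /Ipos /f0; rewrite lee_fin.
- apply: nearW => n; rewrite (@ftc_gt0 f F)//.
    rewrite lee_fin; have := FB n.+1%:R; have := FB n.+1%:R^-1.
    rewrite !ler_norml invr_gt0 ltr0n => /(_ isT) /andP[? ?] /(_ isT) /andP[? ?].
    by lra.
  by rewrite (@le_trans _ _ 1)// ?invf_le1// ler1n.
Qed.

End HalfLine.

(** * The common majorant *)

Section Envelope.
Variable R : realType.
Local Notation mu := (@lebesgue_measure R).
Local Notation HL := (`]0%R, +oo[%classic : set R).
Implicit Types (f F G : R -> R) (a b x : R).

Lemma continuous_powR a x : 0 < x -> {for x, continuous (fun y : R => y `^ a)}.
Proof.
move=> x0; apply/differentiable_continuous/derivable1_diffP.
by have [] := is_derive1_powR a x0.
Qed.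

(* The integrable majorant of (e^(- lambda u) - 1) u^(s - 1) for
   |lambda| = 1 and 0 <= Re lambda. *)
Definition env (s u : R) : R := u `^ (s - 1) * Num.min u 1.

Lemma env_ge0 s u : 0 <= u -> 0 <= env s u.
Proof. by move=> u0; rewrite mulr_ge0 ?powR_ge0// le_min u0 ler01. Qed.

Lemma continuous_env s u : 0 < u -> {for u, continuous (env s)}.
Proof.
move=> u0; apply: continuousM; first exact: continuous_powR.
by apply: continuous_min; [exact: cvg_id|exact: cvg_cst].
Qed.

Lemma env_le1 s u : 0 < u -> u <= 1 -> env s u = u `^ s.
Proof.
move=> u0 u1; rewrite /env min_l// -[X in _ * X]powRr1 ?(ltW u0)//.
by rewrite -powRD ?(gt_eqF u0) ?implybT// subrK.
Qed.

Lemma env_ge1 s u : 1 <= u -> env s u = u `^ (s - 1).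
Proof. by move=> u1; rewrite /env min_r// mulr1. Qed.

(** Comparison with the derivative of atan(x^r), which is of order x^(r - 1) at 0 and x^(- r - 1) at
    infinity. Dominating x^s and x^(s - 1) there requires r <= 1 + s and r <= - s, whence the choice
    of [r]. *)
Lemma integrable_env (s : R) : -1 < s -> s < 0 ->
  mu.-integrable HL (EFin \o env s).
Proof.
move=> s1 s0; pose r : R := Num.min (1 + s) (- s).
have r0 : 0 < r by rewrite lt_min; apply/andP; split; lra.
have rs1 : r <= 1 + s by rewrite ge_min lexx.
have rs : r <= - s by rewrite ge_min lexx orbT.
pose k (x : R) := (1 + (x `^ r) ^+ 2)^-1 * (r * x `^ (r - 1)).
have k0 x : 0 < 1 + (x `^ r) ^+ 2 by rewrite ltr_pwDl// sqr_ge0.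
have ik : mu.-integrable HL (EFin \o k).
  apply: (@integrable_oy _ _ (atan \o (@powR R ^~ r)) (pi / 2)) => x x0.
  - by rewrite mulr_ge0 ?invr_ge0 ?(ltW (k0 x))// mulr_ge0 ?powR_ge0// ltW.
  - apply: continuousM.
      apply: continuousV; first by rewrite gt_eqF.
      apply: continuousD; first exact: cvg_cst.
      by have c := @continuous_powR r x x0; exact: (continuousM c c).
    by apply: continuousM; [exact: cvg_cst|exact: continuous_powR].
  - exact: (is_derive1_comp (is_derive1_atan _) (is_derive1_powR _ x0)).
  - rewrite ler_norml /=; apply/andP; split; apply/ltW.
      exact: atan_gtNpi2.
    exact: atan_ltpi2.
(* Dividing by r removes the factor of the derivative, and 2 compensates the denominator 1 +
   x^(2r). *)
have ik2 : mu.-integrable HL (EFin \o (fun x => 2 / r * k x)).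
  exact: RintegrableZl.
apply: le_Rintegrable ik2 => //.
  by apply: measurable_oy; exact: continuous_env.
move=> /= x; rewrite in_itv/= andbT => x0.
rewrite ger0_norm ?env_ge0 ?(ltW x0)//.
have -> : 2 / r * k x = 2 * x `^ (r - 1) / (1 + (x `^ r) ^+ 2).
  by rewrite /k; field; rewrite !gt_eqF.
rewrite ler_pdivlMr//; have [x1|x1] := leP x 1.
  rewrite env_le1// mulrC ler_pM ?powR_ge0 ?(ltW (k0 _))//.
    have := powR_ge0 x r; suff : x `^ r <= 1 by nra.
    by rewrite -(powRr0 x) ger_powR ?x0// ltW.
  by rewrite ger_powR ?x0//; lra.
rewrite env_ge1 ?(ltW x1)//.
have xr : 1 <= x `^ r by rewrite -(powRr0 x) ler_powR ?ltW.
(* Beyond 1, s - 1 <= - r - 1, and 1 + y^2 <= 2 y^2 for y = x^r; the powers recombine to x^(r -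
   1). *)
apply: (@le_trans _ _ (x `^ (- r - 1) * (2 * (x `^ r) ^+ 2))).
  apply: ler_pM; rewrite ?powR_ge0 ?(ltW (k0 _))//; last by nra.
  by apply: ler_powR; [exact: ltW|lra].
rewrite mulrCA expr2 -!powRD ?(gt_eqF x0) ?implybT//.
by rewrite ler_pM2l//; rewrite (_ : - r - 1 + (r + r) = r - 1)//; ring.
Qed.

End Envelope.

(** * Improper integrals: exhaustion, fundamental theorem, substitution *)

Section HalfLineIntegral.
Variable R : realType.
Local Notation mu := (@lebesgue_measure R).
Local Notation HL := (`]0%R, +oo[%classic : set R).
Implicit Types (f F G : R -> R) (a b x : R).

(** Each point lies in all but finitely many of the intervals, and the restrictions of [f] are
    dominated by its absolute value. *)
Lemma cvg_Rintegral_exhaust f (a b : nat -> R) :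
  mu.-integrable HL (EFin \o f) -> (forall n, 0 < a n) ->
  a n @[n --> \oo] --> 0 -> b n @[n --> \oo] --> +oo ->
  \int[mu]_(x in `[a n, b n]) f x @[n --> \oo] --> \int[mu]_(x in HL) f x.
Proof.
move=> fi a0 ca cb.
have mf : measurable_fun HL f.
  by apply/measurable_EFinP; exact: measurable_int fi.
have abE n : `[a n, b n]%classic = HL `&` `[a n, b n]%classic.
  rewrite setIidr// => x; rewrite /= !in_itv/= andbT => /andP[+ _].
  exact: lt_le_trans.
rewrite (_ : (fun n => _) =
    (fun n => \int[mu]_(x in HL) (f \_ `[a n, b n]%classic) x)); last first.
  by apply/funext => n; rewrite [in LHS]abE Rintegral_mkcondr.
apply: (@cvg_Rintegral_dominated _ (measurableTypeR R) R mu HL _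
  (fun n => f \_ `[a n, b n]%classic) f (fun x => `|f x|)) => //.
- move=> n; apply/measurable_restrict => //.
  exact: measurable_funS mf.
- move=> x; rewrite /= in_itv/= andbT => x0; apply: cvg_near_cst; near=> n.
  rewrite patchE mem_set//= in_itv/=; apply/andP; split.
    by near: n; apply: cvgr_le ca _ x0.
  by near: n; move/cvgryPge : cb; exact.
- exact: integrable_norm.
- move=> n x _; rewrite patchE; case: ifPn => //.
  by rewrite normr0.
Unshelve. all: by end_near. Qed.

Lemma ftc_oy f F (l0 l1 : R) :
  (forall x, 0 < x -> {for x, continuous f}) ->
  (forall x, 0 < x -> is_derive x 1 F (f x)) ->
  mu.-integrable HL (EFin \o f) ->
  F x @[x --> 0^'+] --> l0 -> F x @[x --> +oo] --> l1 ->
  \int[mu]_(x in HL) f x = l1 - l0.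
Proof.
move=> cf dF fi F0 F1.
pose a (n : nat) : R := n.+1%:R^-1; pose b (n : nat) : R := n.+1%:R.
have a0 n : 0 < a n by rewrite invr_gt0.
have cb : b n @[n --> \oo] --> +oo.
  by rewrite (cvg_shiftS (fun n => n%:R : R)); exact: cvgr_idn.
have ca : a n @[n --> \oo] --> 0.
  by apply/(gtr0_cvgV0 _).2 => //; apply: nearW.
have h := cvg_Rintegral_exhaust fi a0 ca cb.
apply: (cvg_unique _ h) => //=.
rewrite (_ : (fun n => _) = (fun n => F (b n) - F (a n))).
  apply: cvgB; first by move/cvg_pinftyP : F1; exact.
  by move/cvg_at_rightP : F0; exact.
apply/funext => n; rewrite /Rintegral (ftc_gt0 _ _ cf dF)//.
by rewrite (@le_trans _ _ 1)// ?invf_le1// ler1n.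
Qed.

(** The substitution is made on [1/(n+1), n+1]. These intervals and their images under [F] both
    exhaust the half-line, so both sides converge to the full integrals. *)
Lemma Rintegration_by_substitution_decreasing_oy F F' G :
  (forall x, 0 < x -> 0 < F x) ->
  (forall x y, 0 < x -> x < y -> F y < F x) ->
  (forall x, 0 < x -> is_derive x 1 F (F' x)) ->
  (forall x, 0 < x -> {for x, continuous F'}) ->
  F x @[x --> 0^'+] --> +oo -> F x @[x --> +oo] --> 0 ->
  (forall x, 0 < x -> {for x, continuous G}) ->
  mu.-integrable HL (EFin \o G) ->
  mu.-integrable HL (EFin \o (fun x => G (F x) * - F' x)) ->
  \int[mu]_(x in HL) G x = \int[mu]_(x in HL) (G (F x) * - F' x).
Proof.
move=> F0 Fdec dF cF' Fy F_0 cG Gi GFi.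
pose a (n : nat) : R := n.+1%:R^-1; pose b (n : nat) : R := n.+1%:R.
have a0 n : 0 < a n by rewrite invr_gt0.
have ab n : a n <= b n by rewrite (@le_trans _ _ 1)// ?invf_le1// ler1n.
have b0 n : 0 < b n by rewrite ltr0n.
have cb : b n @[n --> \oo] --> +oo.
  by rewrite (cvg_shiftS (fun n => n%:R : R)); exact: cvgr_idn.
have ca : a n @[n --> \oo] --> 0.
  by apply/(gtr0_cvgV0 _).2 => //; apply: nearW.
have cFa : F (a n) @[n --> \oo] --> +oo.
  apply: cvg_comp Fy => A [e /= e0 eA].
  near=> n; apply: eA => //=.
  by rewrite sub0r normrN gtr0_norm//; near: n; apply: cvgr_lt ca _ e0.
have cFb : F (b n) @[n --> \oo] --> 0 by move/cvg_pinftyP : F_0; exact.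
(* [F] is decreasing, so the ends of the image interval are swapped. *)
have hG := cvg_Rintegral_exhaust Gi (fun n => F0 _ (b0 n)) cFb cFa.
have hGF := cvg_Rintegral_exhaust GFi a0 ca cb.
apply: (cvg_unique _ hG) => //=; apply: cvg_trans hGF.
apply: near_eq_cvg; apply: nearW => n.
have cF x : 0 < x -> {for x, continuous F}.
  by move=> /dF [dFx _]; exact/differentiable_continuous/derivable1_diffP.
have dFE x : 0 < x -> F^`()%classic x = F' x.
  by move=> /dF [_ <-]; rewrite derive1E.
(* [F'] is the derivative only on the positive half-line, so continuity is transferred through a
   neighbourhood of each positive point. *)
have nearpos x : 0 < x -> {near x, F^`()%classic =1 F'}.
  move=> x0; near=> y; apply: dFE; near: y; exact: lt_nbhsr.
have cdF x : 0 < x -> {for x, continuous F^`()%classic}.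
  move=> x0; have := cF' _ x0; rewrite /prop_for /continuous_at dFE//.
  apply: cvg_trans; apply: near_eq_cvg; near=> y; apply/esym.
  by near: y; exact: nearpos.
have pos x y : 0 < y -> y <= x -> 0 < x by exact: lt_le_trans.
have Fle x y : 0 < x -> x <= y -> F y <= F x.
  by move=> x0; rewrite le_eqVlt => /predU1P[->//|/(Fdec _ _ x0)/ltW].
rewrite /Rintegral integration_by_substitution_decreasing//.
- congr fine; apply: eq_integral => x; rewrite inE/= in_itv/= => /andP[ax _].
  by rewrite !fctE dFE// (pos _ _ (a0 n)).
- move=> x y; rewrite !in_itv/= => _ /andP[ay _].
  by apply: Fdec; rewrite (pos _ _ (a0 n)).
- by move=> x; rewrite in_itv/= => /andP[/ltW/(pos _ _ (a0 n))/cdF].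
- by apply/cvg_ex; exists (F^`()%classic (a n)); apply/cvg_at_right_filter/cdF.
- by apply/cvg_ex; exists (F^`()%classic (b n)); apply/cvg_at_left_filter/cdF.
- split.
  + by move=> x; rewrite in_itv/= => /andP[/ltW/(pos _ _ (a0 n))/dF[]].
  + exact/cvg_at_right_filter/cF.
  + exact/cvg_at_left_filter/cF.
- apply: continuous_in_subspaceT => x; rewrite inE/= in_itv/= => /andP[+ _].
  by move=> /(pos _ _ (F0 _ (b0 n)))/cG.
Unshelve. all: by end_near. Qed.

End HalfLineIntegral.

(** * Derivation rules and trigonometric bounds *)

Section Elementary.
Variable R : realType.
Implicit Types (x y z : R) (f g h : R -> R).

(** Scalings become products here, so that derivatives assembled from these rules can be compared by
    [ring]. *)
Lemma is_deriveMR f g x (df dg : R) : is_derive x 1 f df -> is_derive x 1 g dg ->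
  is_derive x 1 (fun y => f y * g y) (df * g x + f x * dg).
Proof.
move=> df1 dg1; apply: (is_derive_eq (is_deriveM df1 dg1)).
by rewrite /GRing.scale/= addrC mulrC.
Qed.

Lemma is_deriveZR (c : R) f x (df : R) : is_derive x 1 f df ->
  is_derive x 1 (fun y => c * f y) (c * df).
Proof. by move=> df1; apply: (is_derive_eq (is_deriveZ c df1)). Qed.

Lemma is_derive_compR h f x (dh df : R) : is_derive (f x) 1 h dh ->
  is_derive x 1 f df -> is_derive x 1 (fun y => h (f y)) (dh * df).
Proof. exact: is_derive1_comp. Qed.

Lemma is_derive_continuous f x (df : R) : is_derive x 1 f df ->
  {for x, continuous f}.
Proof. by move=> [dfx _]; exact/differentiable_continuous/derivable1_diffP. Qed.

Lemma norm_sin_le x : 0 <= x -> `|sin x| <= x.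
Proof.
rewrite le_eqVlt => /predU1P[<-|x0]; first by rewrite sin0 normr0.
have [|c _] := MVT x0 (fun y _ => is_derive_sin y).
  by apply: continuous_subspaceT; exact: continuous_sin.
rewrite sin0 !subr0 => ->; rewrite normrM (gtr0_norm x0).
by rewrite ler_piMl ?cos_max// ltW.
Qed.

(** The mean value theorem gives |sin c| x with c < x. The factor 1/2 is lost, but only the order in
    x matters. *)
Lemma norm_cosB1_le x : 0 <= x -> `|cos x - 1| <= x ^+ 2.
Proof.
rewrite le_eqVlt => /predU1P[<-|x0]; first by rewrite cos0 subrr normr0 sqr_ge0.
have [|c] := MVT x0 (fun y _ => is_derive_cos y).
  by apply: continuous_subspaceT; exact: continuous_cos.
rewrite in_itv/= => /andP[c0 cx].
rewrite cos0 subr0 => ->; rewrite normrM normrN (gtr0_norm x0) expr2.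
rewrite ler_pM2r// (le_trans (norm_sin_le _)) ?ltW//.
Qed.

Lemma norm_cosB1_le_id x : 0 <= x -> `|cos x - 1| <= x.
Proof.
rewrite le_eqVlt => /predU1P[<-|x0]; first by rewrite cos0 subrr normr0.
have [|c _] := MVT x0 (fun y _ => is_derive_cos y).
  by apply: continuous_subspaceT; exact: continuous_cos.
rewrite cos0 subr0 => ->; rewrite normrM normrN (gtr0_norm x0).
by rewrite ler_piMl ?sin_max// ltW.
Qed.

Lemma norm_sinB_le x : 0 <= x -> `|sin x - x| <= x ^+ 3.
Proof.
rewrite le_eqVlt => /predU1P[<-|x0].
  by rewrite sin0 subrr normr0 exprn_ge0.
have dF y : y \in `]0, x[ -> is_derive y 1 (fun z => sin z - z) (cos y - 1).
  by move=> _; exact: is_deriveB.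
have [|c] := MVT x0 dF.
  apply: continuous_subspaceT => y; apply: continuousB; last exact: cvg_id.
  exact: continuous_sin.
rewrite in_itv/= => /andP[c0 cx].
rewrite sin0 !subr0 => ->; rewrite normrM (gtr0_norm x0) exprSr.
rewrite ler_pM2r// (le_trans (norm_cosB1_le _)) ?ltW//.
by rewrite ltr_pXn2r// nnegrE ltW.
Qed.

(** Up to 1 the quadratic bound suffices; beyond 1 the left side is at most 2 and the quotient at
    least 1/2, whence 4. *)
Lemma norm_cosB1_le_rat z : 0 < z -> `|cos z - 1| <= 4 * (z ^+ 2 / (1 + z ^+ 2)).
Proof.
move=> z0; have p : 0 < 1 + z ^+ 2 by nra.
rewrite mulrA ler_pdivlMr//.
have h1 := norm_cosB1_le (ltW z0); have h0 := normr_ge0 (cos z - 1).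
have h2 : `|cos z - 1| <= 2.
  by rewrite (le_trans (ler_normB _ _))// normr1; have := cos_max z; lra.
move: h0 h1 h2; set n := `|_| => h0 h1 h2.
by have [z1|z1] := leP z 1; nra.
Qed.

(** Near 0 both sin z and z / (1 + z^2) differ from z by at most a cubic term; for large z both are
    bounded. With b = z^2 / (1 + z^2), the two errors up to 1 are at most 2b and b, and so are the
    two terms beyond 1. *)
Lemma norm_sinB_le_rat z : 0 < z ->
  `|sin z - z / (1 + z ^+ 2)| <= 3 * (z ^+ 2 / (1 + z ^+ 2)).
Proof.
move=> z0; have p : 0 < 1 + z ^+ 2 by nra.
have [z1|z1] := leP z 1.
  have -> : sin z - z / (1 + z ^+ 2) = (sin z - z) + z ^+ 3 / (1 + z ^+ 2).
    by field; rewrite gt_eqF.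
  rewrite (le_trans (ler_normD _ _))// normrM normfV (gtr0_norm p).
  rewrite (@ger0_norm _ (z ^+ 3)) ?exprn_ge0 ?(ltW z0)//.
  have := norm_sinB_le (ltW z0).
  set a := z ^+ 3 / _; set b := z ^+ 2 / _.
  have ab : a <= b by rewrite ler_pM2r ?invr_gt0//; nra.
  have zz : z ^+ 2 <= 1 by nra.
  have bz : z ^+ 2 <= 2 * b by rewrite mulrA ler_pdivlMr//; nra.
  have z32 : z ^+ 3 <= z ^+ 2 by rewrite exprS ler_piMl// sqr_ge0.
  by lra.
rewrite (le_trans (ler_normB _ _))// normrM normfV (gtr0_norm p) (gtr0_norm z0).
have h : 1 <= 2 * (z ^+ 2 / (1 + z ^+ 2)) by rewrite mulrA ler_pdivlMr//; nra.
have h2 : z / (1 + z ^+ 2) <= z ^+ 2 / (1 + z ^+ 2).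
  by rewrite ler_pM2r ?invr_gt0//; nra.
by have := sin_max z; lra.
Qed.

Lemma norm_cosB1_le_norm (x : R) : `|cos x - 1| <= `|x|.
Proof. by rewrite -(cos_norm x) norm_cosB1_le_id. Qed.

Lemma norm_sin_le_norm (x : R) : `|sin x| <= `|x|.
Proof.
have [x0|x0] := leP 0 x; first by rewrite (ger0_norm x0) norm_sin_le.
rewrite -normrN -sinN (ltr0_norm x0) norm_sin_le// oppr_ge0 ltW//.
Qed.

Lemma continuous_cosB1 : continuous (fun z : R => cos z - 1).
Proof. by move=> z; apply: continuousB; [exact: continuous_cos|exact: cvg_cst]. Qed.

Lemma norm_cosB1_le2 (z : R) : `|cos z - 1| <= 2.
Proof.
by rewrite (le_trans (ler_normB _ _))// normr1; have := cos_max z; lra.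
Qed.

End Elementary.

(** * The exponential along a rotated ray: derivatives and bounds *)

Section Rotation.
Variable R : realType.
Local Notation mu := (@lebesgue_measure R).
Local Notation HL := (`]0%R, +oo[%classic : set R).
Implicit Types (th u : R).

(* Real and imaginary parts of e^(- lambda u) for lambda = e^(- i th). *)
Definition rot_re th u : R := expR (- (u * cos th)) * cos (u * sin th).
Definition rot_im th u : R := expR (- (u * cos th)) * sin (u * sin th).

(** With [is_derive_rot_im] this is the identity d/dth e^(- lambda u) = i lambda u e^(- lambda u),
    where i lambda = sin th + i cos th. *)
Lemma is_derive_rot_re th u :
  is_derive th 1 (rot_re ^~ u) (u * (sin th * rot_re th u - cos th * rot_im th u)).
Proof.
have dc := is_deriveZR u (is_derive_cos th).
have ds := is_deriveZR u (is_derive_sin th).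
have de := is_derive_compR (is_derive_expR _) (is_deriveN dc).
have dt := is_derive_compR (is_derive_cos _) ds.
apply: (is_derive_eq (is_deriveMR de dt)).
by rewrite /rot_re /rot_im /=; ring.
Qed.

Lemma is_derive_rot_im th u :
  is_derive th 1 (rot_im ^~ u) (u * (sin th * rot_im th u + cos th * rot_re th u)).
Proof.
have dc := is_deriveZR u (is_derive_cos th).
have ds := is_deriveZR u (is_derive_sin th).
have de := is_derive_compR (is_derive_expR _) (is_deriveN dc).
have dt := is_derive_compR (is_derive_sin _) ds.
apply: (is_derive_eq (is_deriveMR de dt)).
by rewrite /rot_re /rot_im /=; ring.
Qed.

(** Real part of d/du e^(- lambda u) = - lambda e^(- lambda u). The derivative in th is - i u times
    this one, so differentiation in th becomes integration by parts in u. *)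
Lemma is_derive_rot_re_r th u :
  is_derive u 1 (rot_re th) (- (cos th * rot_re th u + sin th * rot_im th u)).
Proof.
have dc := is_deriveMR (is_derive_id u 1) (is_derive_cst (cos th) u 1).
have ds := is_deriveMR (is_derive_id u 1) (is_derive_cst (sin th) u 1).
have de := is_derive_compR (is_derive_expR _) (is_deriveN dc).
have dt := is_derive_compR (is_derive_cos _) ds.
apply: (is_derive_eq (is_deriveMR de dt)).
by rewrite /rot_re /rot_im /cst /=; ring.
Qed.

Lemma is_derive_rot_im_r th u :
  is_derive u 1 (rot_im th) (sin th * rot_re th u - cos th * rot_im th u).
Proof.
have dc := is_deriveMR (is_derive_id u 1) (is_derive_cst (cos th) u 1).
have ds := is_deriveMR (is_derive_id u 1) (is_derive_cst (sin th) u 1).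
have de := is_derive_compR (is_derive_expR _) (is_deriveN dc).
have dt := is_derive_compR (is_derive_sin _) ds.
apply: (is_derive_eq (is_deriveMR de dt)).
by rewrite /rot_re /rot_im /cst /=; ring.
Qed.

Lemma norm_rot_re_le th u : `|rot_re th u| <= expR (- (u * cos th)).
Proof.
by rewrite normrM (ger0_norm (expR_ge0 _)) ler_piMr ?expR_ge0 ?cos_max.
Qed.

Lemma norm_rot_im_le th u : `|rot_im th u| <= expR (- (u * cos th)).
Proof.
by rewrite normrM (ger0_norm (expR_ge0 _)) ler_piMr ?expR_ge0 ?sin_max.
Qed.

Lemma expR_rot_le1 th u : 0 <= u -> 0 <= cos th -> expR (- (u * cos th)) <= 1.
Proof. by move=> u0 c0; rewrite -expR0 ler_expR oppr_le0 mulr_ge0. Qed.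

Lemma norm_mul_sin th u : 0 <= u -> `|u * sin th| <= u.
Proof. by move=> u0; rewrite normrM (ger0_norm u0) ler_piMr ?sin_max. Qed.

(** With e = e^(- u cos th) <= 1, the difference splits into e (cos(u sin th) - 1) and e - 1, each
    at most u in absolute value; for large u the triangle inequality gives 2. *)
Lemma norm_rot_reB1_le th u : 0 <= u -> 0 <= cos th ->
  `|rot_re th u - 1| <= 2 * Num.min u 1.
Proof.
move=> u0 c0; have e1 := expR_rot_le1 u0 c0; have e0 := expR_ge0 (- (u * cos th)).
have h1 : `|rot_re th u - 1| <= 2 * 1.
  rewrite (le_trans (ler_normB _ _))// normr1.
  by have := norm_rot_re_le th u; lra.
have h2 : `|rot_re th u - 1| <= 2 * u.
  have -> : rot_re th u - 1 = expR (- (u * cos th)) * (cos (u * sin th) - 1)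
     + (expR (- (u * cos th)) - 1) by rewrite /rot_re; ring.
  rewrite (le_trans (ler_normD _ _))// normrM (ger0_norm e0).
  rewrite mulr2n mulrDl mul1r lerD//.
    apply: (@le_trans _ _ `|cos (u * sin th) - 1|); first by rewrite ler_piMl.
    by rewrite (le_trans (norm_cosB1_le_norm _))// norm_mul_sin.
  rewrite ler0_norm ?subr_le0// opprB.
  have := expR_ge1Dx (- (u * cos th)); have := cos_le1 th; nra.
by rewrite minEle; case: ifP.
Qed.

Lemma norm_rot_im_le_min th u : 0 <= u -> 0 <= cos th ->
  `|rot_im th u| <= Num.min u 1.
Proof.
move=> u0 c0; have e1 := expR_rot_le1 u0 c0; have e0 := expR_ge0 (- (u * cos th)).
rewrite le_min (le_trans (norm_rot_im_le _ _) e1) andbT.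
rewrite normrM (ger0_norm e0) (@le_trans _ _ `|sin (u * sin th)|)//.
  by rewrite ler_piMl.
by rewrite (le_trans (norm_sin_le_norm _))// norm_mul_sin.
Qed.

End Rotation.

(** * Negative powers at 0 and at infinity *)

Section PowerLimits.
Variable R : realType.

Lemma powR_cvg_at_right_lt0 (s : R) : s < 0 -> u `^ s @[u --> 0^'+] --> +oo.
Proof.
move=> s0.
have h : u `^ (- s) @[u --> (0:R)^'+] --> (0 : R) by apply: powR_cvg0; rewrite oppr_gt0.
apply/gtr0_cvgV0.
  by near=> u; rewrite powR_gt0.
apply: cvg_trans h; apply: near_eq_cvg; near=> u.
by rewrite /= powRN.
Unshelve. all: by end_near. Qed.

Lemma powR_cvg_pinfty_lt0 (s : R) : s < 0 -> u `^ s @[u --> +oo] --> 0.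
Proof.
move=> s0.
have h : u `^ (- s) @[u --> (0:R)^'+] --> (0 : R) by apply: powR_cvg0; rewrite oppr_gt0.
apply/cvgrPdist_lt => e e0.
move/cvgrPdist_lt : h => /(_ e e0) [d /= d0 hd].
near=> u.
have u0 : 0 < u by near: u; exact: nbhs_pinfty_gt.
have ud : u^-1 < d.
  rewrite -[ltRHS]invrK ltf_pV2 ?posrE ?invr_gt0//.
  by near: u; apply: nbhs_pinfty_gt; rewrite num_real.
have := hd u^-1; rewrite /= sub0r normrN gtr0_norm ?invr_gt0//.
by rewrite -powR_inv1 ?(ltW u0)// -powRrM mulN1r opprK powR_inv1 ?ltW//; exact.
Unshelve. all: by end_near. Qed.

End PowerLimits.

(** * Domination and integration by parts for g *)

Section RotationIntegrals.
Variable R : realType.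
Local Notation mu := (@lebesgue_measure R).
Local Notation HL := (`]0%R, +oo[%classic : set R).
Variable s : R.
Hypotheses (s1 : -1 < s) (s0 : s < 0).
Implicit Types (th u c : R).

Lemma continuous_rot_re th u : {for u, continuous (rot_re th)}.
Proof. exact: is_derive_continuous (is_derive_rot_re_r th u). Qed.

Lemma continuous_rot_im th u : {for u, continuous (rot_im th)}.
Proof. exact: is_derive_continuous (is_derive_rot_im_r th u). Qed.

(* Real and imaginary parts of g(th), the integral of
   (e^(- lambda u) - 1) u^(s - 1) over u > 0, with lambda = e^(- i th). *)
Definition int_re th : R := \int[mu]_(u in HL) ((rot_re th u - 1) * u `^ (s - 1)).
Definition int_im th : R := \int[mu]_(u in HL) (rot_im th u * u `^ (s - 1)).

Lemma norm_re_integrand_le th u : 0 < u -> 0 <= cos th ->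
  `|(rot_re th u - 1) * u `^ (s - 1)| <= 2 * env s u.
Proof.
move=> u0 c0; rewrite normrM (ger0_norm (powR_ge0 _ _)) /env mulrCA mulrC.
by rewrite ler_wpM2l ?powR_ge0// norm_rot_reB1_le// ltW.
Qed.

Lemma norm_im_integrand_le th u : 0 < u -> 0 <= cos th ->
  `|rot_im th u * u `^ (s - 1)| <= 2 * env s u.
Proof.
move=> u0 c0; rewrite normrM (ger0_norm (powR_ge0 _ _)) /env mulrCA mulrC.
rewrite ler_wpM2l ?powR_ge0// (le_trans (norm_rot_im_le_min (ltW u0) c0))//.
by rewrite ler_peMl ?ler1n// le_min ler01 ltW.
Qed.

Lemma continuous_re_integrand th u : 0 < u ->
  {for u, continuous (fun u => (rot_re th u - 1) * u `^ (s - 1))}.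
Proof.
move=> u0; apply: continuousM; last exact: continuous_powR.
by apply: continuousB; [exact: continuous_rot_re|exact: cvg_cst].
Qed.

Lemma continuous_im_integrand th u : 0 < u ->
  {for u, continuous (fun u => rot_im th u * u `^ (s - 1))}.
Proof.
by move=> u0; apply: continuousM; [exact: continuous_rot_im|exact: continuous_powR].
Qed.

Let integrable_env2 (c : R) : mu.-integrable HL (EFin \o (fun u => c * env s u)).
Proof. by apply: RintegrableZl => //; exact: integrable_env. Qed.

Lemma integrable_re_integrand th : 0 <= cos th ->
  mu.-integrable HL (EFin \o (fun u => (rot_re th u - 1) * u `^ (s - 1))).
Proof.
move=> c0; apply: le_Rintegrable (integrable_env2 2) => //.
  by apply: measurable_oy => u; exact: continuous_re_integrand.
by move=> u /HL_gt0 u0; exact: norm_re_integrand_le.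
Qed.

Lemma integrable_im_integrand th : 0 <= cos th ->
  mu.-integrable HL (EFin \o (fun u => rot_im th u * u `^ (s - 1))).
Proof.
move=> c0; apply: le_Rintegrable (integrable_env2 2) => //.
  by apply: measurable_oy => u; exact: continuous_im_integrand.
by move=> u /HL_gt0 u0; exact: norm_im_integrand_le.
Qed.

(** Up to 1 the exponential is dropped. Beyond 1, u e^(- c u) <= 1/c, a consequence of 1 + y <= e^y,
    trades a power of u for 1/c. *)
Lemma powR_expR_le_env c u : 0 < u -> 0 < c ->
  u `^ s * expR (- (u * c)) <= (1 + c^-1) * env s u.
Proof.
move=> u0 c0; have ci : 0 < c^-1 by rewrite invr_gt0.
have uc : 0 < u * c by rewrite mulr_gt0.
have e1 : expR (- (u * c)) <= 1 by rewrite -expR0 ler_expR oppr_le0 ltW.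
have [u1|u1] := leP u 1.
  rewrite env_le1// mulrC ler_wpM2r ?powR_ge0//; lra.
rewrite env_ge1 ?(ltW u1)//.
have -> : u `^ s = u `^ (s - 1) * u.
  by rewrite -[X in _ * X]powRr1 ?(ltW u0)// -powRD ?(gt_eqF u0) ?implybT// subrK.
rewrite -mulrA mulrC ler_wpM2r ?powR_ge0//.
have : u * c * expR (- (u * c)) <= 1.
  rewrite expRN ler_pdivrMr ?expR_gt0// mul1r.
  by have := expR_ge1Dx (u * c); lra.
rewrite mulrAC -ler_pdivlMr// => h.
by rewrite (le_trans h)// mul1r; lra.
Qed.

Let comb_bound (a b p q e : R) : `|a| <= 1 -> `|b| <= 1 -> `|p| <= e -> `|q| <= e ->
  `|a * p + b * q| <= 2 * e.
Proof.
move=> a1 b1 pe qe; rewrite (le_trans (ler_normD _ _))// !normrM.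
have := normr_ge0 a; have := normr_ge0 b; have := normr_ge0 p; have := normr_ge0 q.
nra.
Qed.

(** The bound depends on [th] only through the lower bound [c] of its cosine, so it dominates the
    derivative on a whole neighbourhood of angles. *)
Lemma norm_re_deriv_le c th u : 0 < u -> 0 < c -> c <= cos th ->
  `|u `^ s * (sin th * rot_re th u - cos th * rot_im th u)| <=
  2 * (1 + c^-1) * env s u.
Proof.
move=> u0 c0 cc; rewrite normrM (ger0_norm (powR_ge0 _ _)) -mulrA.
apply: le_trans (ler_wpM2l (ler0n _ 2) (powR_expR_le_env u0 c0)).
rewrite [leRHS]mulrCA ler_wpM2l ?powR_ge0// -mulNr.
have h : expR (- (u * cos th)) <= expR (- (u * c)).
  by rewrite ler_expR lerN2 ler_pM2l.
by apply: comb_bound; rewrite ?normrN ?sin_max ?cos_max ?(le_trans _ h)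
  ?norm_rot_re_le ?norm_rot_im_le.
Qed.

Lemma norm_im_deriv_le c th u : 0 < u -> 0 < c -> c <= cos th ->
  `|u `^ s * (sin th * rot_im th u + cos th * rot_re th u)| <=
  2 * (1 + c^-1) * env s u.
Proof.
move=> u0 c0 cc; rewrite normrM (ger0_norm (powR_ge0 _ _)) -mulrA.
apply: le_trans (ler_wpM2l (ler0n _ 2) (powR_expR_le_env u0 c0)).
rewrite [leRHS]mulrCA ler_wpM2l ?powR_ge0//.
have h : expR (- (u * cos th)) <= expR (- (u * c)).
  by rewrite ler_expR lerN2 ler_pM2l.
by apply: comb_bound; rewrite ?sin_max ?cos_max ?(le_trans _ h)
  ?norm_rot_re_le ?norm_rot_im_le.
Qed.

Lemma continuous_re_deriv th u : 0 < u ->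
  {for u, continuous (fun u => u `^ s * (sin th * rot_re th u - cos th * rot_im th u))}.
Proof.
move=> u0; apply: continuousM; first exact: continuous_powR.
apply: continuousB; apply: continuousM; try exact: cvg_cst.
  exact: continuous_rot_re.
exact: continuous_rot_im.
Qed.

Lemma continuous_im_deriv th u : 0 < u ->
  {for u, continuous (fun u => u `^ s * (sin th * rot_im th u + cos th * rot_re th u))}.
Proof.
move=> u0; apply: continuousM; first exact: continuous_powR.
apply: continuousD; apply: continuousM; try exact: cvg_cst.
  exact: continuous_rot_im.
exact: continuous_rot_re.
Qed.

Lemma integrable_re_deriv th : 0 < cos th -> mu.-integrable HL
  (EFin \o (fun u => u `^ s * (sin th * rot_re th u - cos th * rot_im th u))).
Proof.
move=> c0; apply: le_Rintegrable (integrable_env2 (2 * (1 + (cos th)^-1))) => //.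
  by apply: measurable_oy => u; exact: continuous_re_deriv.
by move=> u /HL_gt0 u0; exact: norm_re_deriv_le.
Qed.

Lemma integrable_im_deriv th : 0 < cos th -> mu.-integrable HL
  (EFin \o (fun u => u `^ s * (sin th * rot_im th u + cos th * rot_re th u))).
Proof.
move=> c0; apply: le_Rintegrable (integrable_env2 (2 * (1 + (cos th)^-1))) => //.
  by apply: measurable_oy => u; exact: continuous_im_deriv.
by move=> u /HL_gt0 u0; exact: norm_im_deriv_le.
Qed.

(** These are the boundary terms of the integrations by parts: at most 2 u^(s + 1) near 0 and 2 u^s
    at infinity, with s + 1 > 0 > s. *)
Lemma cvg_boundary (f : R -> R) : (forall u, 0 < u -> `|f u| <= 2 * Num.min u 1) ->
  u `^ s * f u @[u --> 0^'+] --> 0 /\ u `^ s * f u @[u --> +oo] --> 0.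
Proof.
move=> hf; split.
- have h : 2 * u `^ (s + 1) @[u --> (0:R)^'+] --> 2 * (0 : R).
    by apply: cvgM; [exact: cvg_cst|apply: powR_cvg0; rewrite -ltrBlDr sub0r].
  rewrite mulr0 in h; apply: norm_cvg0.
  apply: squeeze_cvgr h; last exact: (cvg_cst 0).
  near=> u; have u0 : 0 < u by [].
  rewrite normr_ge0/= normrM (ger0_norm (powR_ge0 _ _)).
  rewrite powRD ?(gt_eqF u0) ?implybT// powRr1 ?(ltW u0)// mulrCA ler_wpM2l ?powR_ge0//.
  by rewrite (le_trans (hf _ u0))// ler_wpM2l// ge_min lexx.
- have h : 2 * u `^ s @[u --> +oo] --> 2 * (0 : R).
    by apply: cvgM; [exact: cvg_cst|exact: powR_cvg_pinfty_lt0].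
  rewrite mulr0 in h; apply: norm_cvg0.
  apply: squeeze_cvgr h; last exact: (cvg_cst 0).
  near=> u; have u0 : 0 < u by near: u; exact: nbhs_pinfty_gt.
  rewrite normr_ge0/= normrM (ger0_norm (powR_ge0 _ _)).
  rewrite mulrC ler_wpM2r ?powR_ge0//.
  by rewrite (le_trans (hf _ u0))// ger_pMr// ge_min lexx orbT.
Unshelve. all: by end_near. Qed.

(** The primitive is u^s (rot_re th u - 1). The integrand on the right is also the derivative in th
    of the integrand of [int_im], which closes the system for g. *)
Lemma int_re_parts th : 0 < cos th ->
  s * int_re th = \int[mu]_(u in HL)
    (u `^ s * (sin th * rot_im th u + cos th * rot_re th u)).
Proof.
move=> c0; have ci := ltW c0.
pose f u := s * ((rot_re th u - 1) * u `^ (s - 1)) +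
  (-1) * (u `^ s * (sin th * rot_im th u + cos th * rot_re th u)).
have fi : mu.-integrable HL (EFin \o f).
  apply: RintegrableD => //; apply: RintegrableZl => //.
    exact: integrable_re_integrand.
  exact: integrable_im_deriv.
have [b0 b1] := @cvg_boundary (fun u => rot_re th u - 1)
  (fun _ h => norm_rot_reB1_le (ltW h) ci).
have cf u : 0 < u -> {for u, continuous f}.
  move=> u0; apply: continuousD; apply: continuousM; try exact: cvg_cst.
    exact: continuous_re_integrand.
  exact: continuous_im_deriv.
have df u : 0 < u -> is_derive u 1 (fun u => u `^ s * (rot_re th u - 1)) (f u).
  move=> u0; have dp := is_derive1_powR s u0.
  have dr : is_derive u 1 (fun u => rot_re th u - 1)
      (- (cos th * rot_re th u + sin th * rot_im th u)).
    apply: is_derive_eq (is_deriveB (is_derive_rot_re_r th u) _) _.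
    by rewrite subr0.
  by apply: (is_derive_eq (is_deriveMR dp dr)); rewrite /f; ring.
have := ftc_oy cf df fi b0 b1; rewrite subrr /f RintegralD//; last 2 first.
- by apply: RintegrableZl => //; exact: integrable_re_integrand.
- by apply: RintegrableZl => //; exact: integrable_im_deriv.
rewrite !RintegralZl//; last 2 first.
- exact: integrable_im_deriv.
- exact: integrable_re_integrand.
by rewrite mulN1r => /subr0_eq.
Qed.

Lemma int_im_parts th : 0 < cos th ->
  s * int_im th = - \int[mu]_(u in HL)
    (u `^ s * (sin th * rot_re th u - cos th * rot_im th u)).
Proof.
move=> c0; have ci := ltW c0.
pose f u := s * (rot_im th u * u `^ (s - 1)) +
  u `^ s * (sin th * rot_re th u - cos th * rot_im th u).
have fi : mu.-integrable HL (EFin \o f).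
  apply: RintegrableD => //; last exact: integrable_re_deriv.
  by apply: RintegrableZl => //; exact: integrable_im_integrand.
have hb u : 0 < u -> `|rot_im th u| <= 2 * Num.min u 1.
  move=> u0; rewrite (le_trans (norm_rot_im_le_min (ltW u0) ci))//.
  by rewrite ler_peMl ?ler1n// le_min ler01 ltW.
have [b0 b1] := cvg_boundary hb.
have cf u : 0 < u -> {for u, continuous f}.
  move=> u0; apply: continuousD; last exact: continuous_re_deriv.
  by apply: continuousM; [exact: cvg_cst|exact: continuous_im_integrand].
have df u : 0 < u -> is_derive u 1 (fun u => u `^ s * rot_im th u) (f u).
  move=> u0; have dp := is_derive1_powR s u0.
  apply: (is_derive_eq (is_deriveMR dp (is_derive_rot_im_r th u))).
  by rewrite /f; ring.
have := ftc_oy cf df fi b0 b1; rewrite subrr /f RintegralD//; last 2 first.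
- by apply: RintegrableZl => //; exact: integrable_im_integrand.
- exact: integrable_re_deriv.
rewrite !RintegralZl//; last exact: integrable_im_integrand.
by move/eqP; rewrite addr_eq0 => /eqP.
Qed.

End RotationIntegrals.

(** * The differential equation g' = i s g and its endpoint *)

Section RotationSolution.
Variable R : realType.
Local Notation mu := (@lebesgue_measure R).
Local Notation HL := (`]0%R, +oo[%classic : set R).
Variable s : R.
Hypotheses (s1 : -1 < s) (s0 : s < 0).
Implicit Types (th u c x : R).

Lemma cos_le_cos_norm (x b : R) : `|x| <= b -> b <= pi -> cos b <= cos x.
Proof.
move=> xb bpi; rewrite -(cos_norm x); move: xb; rewrite le_eqVlt => /predU1P[->//|xb].
by apply/ltW; rewrite ltr_cos// in_itv/= ?normr_ge0 ?(ltW (lt_le_trans xb bpi))//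
  bpi andbT (le_trans _ (ltW xb)).
Qed.

Lemma is_derive_under_integral (f df : R -> R -> R) (g : R -> R) th (b : R) :
  `|th| < b ->
  (forall x, `|x| < b -> mu.-integrable HL (EFin \o f x)) ->
  (forall x u, `|x| < b -> 0 < u -> is_derive x 1 (f ^~ u) (df x u)) ->
  mu.-integrable HL (EFin \o g) ->
  (forall x u, `|x| < b -> 0 < u -> `|df x u| <= g u) ->
  is_derive th 1 (fun x => \int[mu]_(u in HL) f x u) (\int[mu]_(u in HL) df th u).
Proof.
move=> thb fi fd gi dfg.
have inb (x : R) : `]- b, b[%classic x = (`|x| < b) :> Prop.
  by rewrite /= in_itv/= ltr_norml.
have d1 x u : `|x| < b -> 0 < u -> partial1of2 f x u = df x u.
  by move=> xb u0; rewrite partial1of2E; have [_] := fd x u xb u0.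
have h1 : `]- b, b[%classic th by rewrite inb.
have h2 x : `]- b, b[%classic x -> mu.-integrable HL (EFin \o f x).
  by rewrite inb; exact: fi.
have h3 x u : `]- b, b[%classic x -> HL u -> derivable (f ^~ u) x 1.
  by rewrite inb => xb /HL_gt0 u0; have [] := fd x u xb u0.
have h4 u : 0 <= `|g u| by [].
(* The absolute value of [g] serves as majorant because it is nonnegative at every u, also off the
   half-line. *)
have h5 : mu.-integrable HL (EFin \o (fun u => `|g u|)) by exact: integrable_norm.
have h6 x u : `]- b, b[%classic x -> HL u -> `|partial1of2 f x u| <= `|g u|.
  rewrite inb => xb /HL_gt0 u0; rewrite d1//.
  by rewrite (le_trans (dfg _ _ xb u0))// ler_norm.
apply: DeriveDef.
  exact: (derivable_under_integral _ h1 h2 h3 h4 h5 h6).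
rewrite -derive1E (differentiation_under_integral _ h1 h2 h3 h4 h5 h6)//.
by apply: eq_Rintegral => u; rewrite inE => /HL_gt0 u0; rewrite d1.
Qed.

(** The midpoint of |th| and pi/2 leaves room around [th], and its own cosine is the lower bound. *)
Lemma near_pihalf th : `|th| < pi / 2 ->
  exists2 b, `|th| < b & exists2 c, 0 < c & forall x : R, `|x| < b -> c <= cos x.
Proof.
move=> th2; exists ((`|th| + pi / 2) / 2); first by lra.
exists (cos ((`|th| + pi / 2) / 2)).
  by apply: cos_gt0_pihalf; have := normr_ge0 th; lra.
move=> x xb; apply: cos_le_cos_norm; first exact: ltW.
by have := pi_ge2 R; lra.
Qed.

Let mulu u : 0 < u -> u * u `^ (s - 1) = u `^ s.
Proof.
move=> u0; rewrite -[X in X * _]powRr1 ?(ltW u0)// -powRD ?(gt_eqF u0) ?implybT//.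
by rewrite addrC subrK.
Qed.

(** Integration by parts has expressed - s [int_im] as the integral of the differentiated integrand,
    so only differentiation under the integral remains. *)
Lemma is_derive_int_re th : `|th| < pi / 2 ->
  is_derive th 1 (int_re s) (- (s * int_im s th)).
Proof.
move=> /[dup] /near_pihalf [b thb [c c0 hc]] th2.
have cth : 0 < cos th by rewrite (lt_le_trans c0)// hc.
rewrite int_im_parts// opprK.
apply: (@is_derive_under_integral
  (fun th u => (rot_re th u - 1) * u `^ (s - 1))
  (fun th u => u `^ s * (sin th * rot_re th u - cos th * rot_im th u))
  (fun u => 2 * (1 + c^-1) * env s u) th b thb).
- by move=> x /hc cx; apply: integrable_re_integrand => //; exact: le_trans (ltW c0) cx.
- move=> x u xb u0.
  have dr : is_derive x 1 (fun x => rot_re x u - 1)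
      (u * (sin x * rot_re x u - cos x * rot_im x u)).
    apply: is_derive_eq (is_deriveB (is_derive_rot_re x u) _) _.
    by rewrite subr0.
  apply: (is_derive_eq (is_deriveMR dr (is_derive_cst (u `^ (s - 1)) x 1))).
  by rewrite /cst mulr0 addr0 mulrAC mulu.
- by apply: RintegrableZl => //; exact: integrable_env.
- by move=> x u /hc cx u0; exact: norm_re_deriv_le.
Qed.

Lemma is_derive_int_im th : `|th| < pi / 2 ->
  is_derive th 1 (int_im s) (s * int_re s th).
Proof.
move=> /[dup] /near_pihalf [b thb [c c0 hc]] th2.
have cth : 0 < cos th by rewrite (lt_le_trans c0)// hc.
rewrite int_re_parts//.
apply: (@is_derive_under_integral
  (fun th u => rot_im th u * u `^ (s - 1))
  (fun th u => u `^ s * (sin th * rot_im th u + cos th * rot_re th u))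
  (fun u => 2 * (1 + c^-1) * env s u) th b thb).
- by move=> x /hc cx; apply: integrable_im_integrand => //; exact: le_trans (ltW c0) cx.
- move=> x u xb u0.
  apply: (is_derive_eq (is_deriveMR (is_derive_rot_im x u)
    (is_derive_cst (u `^ (s - 1)) x 1))).
  by rewrite /cst mulr0 addr0 mulrAC mulu.
- by apply: RintegrableZl => //; exact: integrable_env.
- by move=> x u /hc cx u0; exact: norm_im_deriv_le.
Qed.

Lemma int_im0 : int_im s 0 = 0.
Proof.
transitivity (\int[mu]_(u in HL) (0 : R)); last by rewrite Rintegral_cst// mul0r.
apply: eq_Rintegral => u _.
by rewrite /rot_im sin0 mulr0 sin0 mulr0 mul0r.
Qed.

(* g' = i s g, hence g(th) = e^(i s th) g(0). *)
Lemma int_re_im_solution th : 0 <= th -> th < pi / 2 ->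
  int_re s th = int_re s 0 * cos (s * th) /\ int_im s th = int_re s 0 * sin (s * th).
Proof.
move=> th0 th2.
(* [U] and [V] are the real and imaginary parts of e^(- i s x) g(x), which has derivative 0. *)
pose U x := int_re s x * cos (s * x) + int_im s x * sin (s * x).
pose V x := int_im s x * cos (s * x) - int_re s x * sin (s * x).
have dtrig x : is_derive x 1 (fun x => cos (s * x)) (- sin (s * x) * s) /\
    is_derive x 1 (fun x => sin (s * x)) (cos (s * x) * s).
  have d := is_deriveZR s (is_derive_id x 1); rewrite mulr1 in d.
  by split; [exact: is_derive_compR (is_derive_cos _) d
            |exact: is_derive_compR (is_derive_sin _) d].
have dU x : `|x| < pi / 2 -> is_derive x 1 U 0.
  move=> x2; have [dc ds] := dtrig x.
  have := is_deriveD (is_deriveMR (is_derive_int_re x2) dc)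
    (is_deriveMR (is_derive_int_im x2) ds).
  by move=> d; apply: (is_derive_eq d); ring.
have dV x : `|x| < pi / 2 -> is_derive x 1 V 0.
  move=> x2; have [dc ds] := dtrig x.
  have := is_deriveB (is_deriveMR (is_derive_int_im x2) dc)
    (is_deriveMR (is_derive_int_re x2) ds).
  by move=> d; apply: (is_derive_eq d); ring.
have cst_on (W : R -> R) :
    (forall x : R, `|x| < pi / 2 -> is_derive x 1 W 0) -> W th = W 0.
  move=> dW; have lt2 x : 0 <= x -> x <= th -> `|x| < pi / 2.
    by move=> x0 xt; rewrite ger0_norm// (le_lt_trans xt).
  have [||c _ h] := @MVT_segment R W (fun=> 0) 0 th th0.
  - by move=> x; rewrite in_itv/= => /andP[x0 xt]; apply/dW/lt2; exact: ltW.
  - apply: derivable_within_continuous => x; rewrite in_itv/= => /andP[x0 xt].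
    by have [] := dW x (lt2 x x0 xt).
  - by move: h; rewrite mul0r => /subr0_eq.
have hU := cst_on U dU; have hV := cst_on V dV.
rewrite /U mulr0 cos0 sin0 mulr0 mulr1 addr0 in hU.
rewrite /V mulr0 cos0 sin0 mulr0 mulr1 subr0 int_im0 in hV.
(* Multiplying back by e^(i s th) recovers g, in real form through cos^2 + sin^2 = 1. *)
have cs := cos2Dsin2 (s * th).
set C := cos (s * th) in hU hV cs *; set S := sin (s * th) in hU hV cs *.
split.
  transitivity (int_re s th * (C ^+ 2 + S ^+ 2)); first by rewrite cs mulr1.
  transitivity ((int_re s th * C + int_im s th * S) * C
    - S * (int_im s th * C - int_re s th * S)); first by ring.
  by rewrite hU hV mulr0 subr0.
transitivity (int_im s th * (C ^+ 2 + S ^+ 2)); first by rewrite cs mulr1.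
transitivity ((int_re s th * C + int_im s th * S) * S
  + C * (int_im s th * C - int_re s th * S)); first by ring.
by rewrite hU hV mulr0 addr0.
Qed.

(** At pi/2 the differentiated integrand, of size u^s, is no longer absolutely integrable at
    infinity, so the equation stops short of the endpoint. The majorant of g itself only asks for
    cos th >= 0 and survives there. *)
Lemma int_re_im_pihalf :
  int_re s (pi / 2) = int_re s 0 * cos (s * (pi / 2)) /\
  int_im s (pi / 2) = int_re s 0 * sin (s * (pi / 2)).
Proof.
have p2 : 0 < pi / 2 :> R by rewrite divr_gt0 ?pi_gt0.
pose th_ n : R := pi / 2 * (1 - n.+1%:R^-1).
have th0 n : 0 <= th_ n.
  by rewrite mulr_ge0 ?(ltW p2)// subr_ge0 invf_le1 ?ler1n.
have th2 n : th_ n < pi / 2.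
  by rewrite gtr_pMr// ltrBlDr ltrDl invr_gt0.
have c0 n : 0 <= cos (th_ n).
  by apply: cos_ge0_pihalf; rewrite (ltW (th2 n)) (le_trans _ (th0 n))// oppr_le0 ltW.
have cth : th_ n @[n --> \oo] --> pi / 2.
  have -> : pi / 2 = pi / 2 * (1 - 0) :> R by rewrite subr0 mulr1.
  apply: cvgM; first exact: cvg_cst.
  by apply: cvgB; [exact: cvg_cst|exact: cvg_harmonic].
have env2 : mu.-integrable HL (EFin \o (fun u => 2 * env s u)).
  by apply: RintegrableZl => //; exact: integrable_env.
have csth (f : R -> R) : continuous f -> f (s * th_ n) @[n --> \oo] --> f (s * (pi / 2)).
  move=> cf; apply: (cvg_comp (fun n => s * th_ n) f); last exact: cf.
  by apply: cvgM; [exact: cvg_cst|].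
have hre : int_re s (th_ n) @[n --> \oo] --> int_re s (pi / 2).
  apply: (@cvg_Rintegral_dominated _ (measurableTypeR R) R mu HL _
    (fun n u => (rot_re (th_ n) u - 1) * u `^ (s - 1)) _ (fun u => 2 * env s u)) => //.
  - by move=> n; apply: measurable_oy => u; exact: continuous_re_integrand.
  - move=> u _; apply: cvgM; last exact: cvg_cst.
    apply: cvgB; last exact: cvg_cst.
    exact: (cvg_comp th_ _ cth (is_derive_continuous (is_derive_rot_re (pi / 2) u))).
  - by move=> n u /HL_gt0 u0; exact: norm_re_integrand_le.
have him : int_im s (th_ n) @[n --> \oo] --> int_im s (pi / 2).
  apply: (@cvg_Rintegral_dominated _ (measurableTypeR R) R mu HL _
    (fun n u => rot_im (th_ n) u * u `^ (s - 1)) _ (fun u => 2 * env s u)) => //.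
  - by move=> n; apply: measurable_oy => u; exact: continuous_im_integrand.
  - move=> u _; apply: cvgM; last exact: cvg_cst.
    exact: (cvg_comp th_ _ cth (is_derive_continuous (is_derive_rot_im (pi / 2) u))).
  - by move=> n u /HL_gt0 u0; exact: norm_im_integrand_le.
split.
- apply: (cvg_unique _ hre) => //=.
  rewrite (_ : (fun n => _) = (fun n => int_re s 0 * cos (s * th_ n))).
    by apply: cvgM; [exact: cvg_cst|exact/csth/continuous_cos].
  by apply/funext => n; have [] := int_re_im_solution (th0 n) (th2 n).
- apply: (cvg_unique _ him) => //=.
  rewrite (_ : (fun n => _) = (fun n => int_re s 0 * sin (s * th_ n))).
    by apply: cvgM; [exact: cvg_cst|exact/csth/continuous_sin].
  by apply/funext => n; have [] := int_re_im_solution (th0 n) (th2 n).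
Qed.

(* At th = 0 integration by parts turns int_re into Euler's integral. *)
Lemma int_re0 : s * int_re s 0 = \int[mu]_(u in HL) (u `^ s * expR (- u)).
Proof.
rewrite int_re_parts ?cos0//; apply: eq_Rintegral => u _.
by rewrite /rot_re /rot_im sin0 cos0 !(mul0r, mulr0) cos0 !(mulr1, mul1r, add0r).
Qed.

End RotationSolution.

(** * Complex limits by components *)

Section ComplexLimit.
Variable R : realType.

Lemma cvg_complex (T : Type) (F : set_system T) (FF : Filter F)
    (f g : T -> R) (a b : R) :
  f @ F --> a -> g @ F --> b ->
  (f t +i* g t) @[t --> F] --> ((a +i* b) : R[i]^o).
Proof.
move=> fa gb.
apply: (proj2 (@cvgrPdist_lt R[i] (R[i]^o) T F _ (fun t => f t +i* g t) (a +i* b))).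
(* A positive element of [R[i]] has zero imaginary part, so the radius is real. *)
move=> [e e']; rewrite ltcE/= => /andP[/eqP -> e0].
have e20 : 0 < e / 2 by rewrite divr_gt0.
near=> t.
have ha : `|a - f t| < e / 2 by near: t; move/cvgrPdist_lt : fa; exact.
have hb : `|b - g t| < e / 2 by near: t; move/cvgrPdist_lt : gb; exact.
have -> : (a +i* b - f t +i* g t : R[i]) = (a - f t) +i* (b - g t) by simpc.
rewrite normc_def ltcR /=.
rewrite -[ltRHS]gtr0_norm// -sqrtr_sqr ltr_sqrt ?exprn_gt0//.
move: ha hb; rewrite !ltr_norml => /andP[? ?] /andP[? ?]; nra.
Unshelve. all: by end_near. Qed.

Lemma cexp_i (t w p : R) :
  cexp ('i%C * t%:C * w%:C) * p%:C = (cos (t * w) * p) +i* (sin (t * w) * p).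
Proof. by rewrite /cexp /=; simpc; rewrite expR0 !mul1r. Qed.

End ComplexLimit.

(** * Global regularity and bounds for phi *)

Section TestFunction.
Variables (R : realType) (phi : R -> R).

(** Off its closed support [phi] is locally zero; on the support, smoothness on [U] applies, at
    derivative order 0. *)
Lemma smooth_supp_derivable (U : set R) : smooth_on U phi ->
  tsupport phi `<=` U -> forall x, derivable phi x 1.
Proof.
move=> smooth supp x; have [xU|xU] := pselect (tsupport phi x).
  exact: (smooth 0%N x (supp _ xU)).
have : nbhs x (~` tsupport phi).
  apply: open_nbhs_nbhs; split => //.
  exact/closed_openC/closed_closure.
move=> nx; have phi0 : {near x, cst 0 =1 phi}.
  near=> y; apply/esym/eqP/negPn/negP => yn0.
  have : (~` tsupport phi) y by near: y.
  by apply; exact: subset_closure.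
exact: near_eq_derivable phi0 (derivable_cst _ _ _).
Unshelve. all: by end_near. Qed.

Lemma compact_supp_bound : compact (tsupport phi) -> continuous phi ->
  exists M A : R, [/\ 0 < M, 1 <= A, forall x, `|phi x| <= M &
    forall x, A < x -> phi x = 0].
Proof.
move=> csupp cphi.
have supp0 x : ~ tsupport phi x -> phi x = 0.
  move=> h; apply/eqP/negPn/negP => yn0; apply: h; exact: subset_closure.
have [M [Mr hM]] :=
  compact_bounded (continuous_compact (continuous_subspaceT cphi) csupp).
have [A [Ar hA]] := compact_bounded csupp.
(* The added 1 exceeds both thresholds strictly and gives [0 < M] and [1 <= A]. *)
exists (`|M| + 1), (`|A| + 1); split.
- by rewrite ltr_wpDl.
- by rewrite lerDr.
- move=> x; have [/supp0 ->|xs] := pselect (~ tsupport phi x).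
    by rewrite normr0 addr_ge0.
  apply: (hM (`|M| + 1)); first by rewrite (le_lt_trans (ler_norm _))// ltrDl.
  by exists x => //; apply: contrapT.
- move=> x Ax; apply: supp0 => /(hA (`|A| + 1)) h.
  have : `|x| <= `|A| + 1 by apply: h; rewrite (le_lt_trans (ler_norm _))// ltrDl.
  by rewrite leNgt (lt_le_trans Ax)// ler_norm.
Qed.

(** Within distance d of 0 the difference quotient is at most |l| + 1; farther away, 2M <= (2M / d)
    x. *)
Lemma derivable_lipschitz0 (M : R) : derivable phi 0 1 -> (forall x, `|phi x| <= M) ->
  exists L : R, forall x, 0 < x -> `|phi x - phi 0| <= L * x.
Proof.
move=> d0 phiM.
have M0 : 0 <= M by rewrite (le_trans _ (phiM 0)).
have [l hl] : exists l, h^-1 * (phi h - phi 0) @[h --> 0^'] --> (l : R).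
  move/cvg_ex : d0 => /= [l hl]; exists l; apply: cvg_trans hl.
  apply: near_eq_cvg; near=> h; rewrite /= addr0.
  by rewrite /GRing.scale/= mulr1.
move/cvgrPdist_lt : hl => /(_ 1 ltr01) [d /= d0' hd].
exists (`|l| + 1 + 2 * M / d) => x x0.
have c0 : 0 <= 2 * M / d by rewrite divr_ge0 ?mulr_ge0// ltW.
have l0 := normr_ge0 l.
have [xd|xd] := ltP x d.
  have := hd x; rewrite /= sub0r normrN (gtr0_norm x0) => /(_ xd); rewrite gt_eqF//.
  move=> /(_ isT) h.
  have {}h : `|x^-1 * (phi x - phi 0)| <= `|l| + 1.
    rewrite -[X in `|X|](subKr l) (le_trans (ler_normB _ _))// lerD2l ltW//.
  rewrite normrM normfV (gtr0_norm x0) mulrC ler_pdivrMr// in h.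
  by rewrite (le_trans h)// ler_pM2r// lerDl.
rewrite (le_trans (ler_normB _ _))// (@le_trans _ _ (2 * M))//.
  by have := phiM x; have := phiM 0; lra.
have h : 2 * M <= 2 * M / d * x.
  by rewrite mulrAC ler_pdivlMr// ler_wpM2l// mulr_ge0.
by rewrite (le_trans h)// ler_wpM2r ?(ltW x0)// lerDr addr_ge0.
Unshelve. all: by end_near. Qed.

End TestFunction.

(** * The cases alpha < 1 and alpha > 1 *)

Section Oscillatory.
Variable R : realType.
Local Notation mu := (@lebesgue_measure R).
Local Notation HL := (`]0%R, +oo[%classic : set R).
Variables (alpha : R) (phi : R -> R) (M A : R).
Hypotheses (alpha_gt0 : 0 < alpha) (cphi : continuous phi).
Hypotheses (M_gt0 : 0 < M) (A_ge1 : 1 <= A).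
Hypotheses (phiM : forall x, `|phi x| <= M) (phiA : forall x, A < x -> phi x = 0).
Implicit Types (c : R -> R) (s t x u : R).

(** After removing x^(s - 1), what is left is |phi x| x <= M A min(x, 1), where [A] absorbs x
    between 1 and the end of the support. *)
Lemma phi_powR_le_env s x : 0 < x -> `|phi x| * x `^ s <= M * A * env s x.
Proof.
move=> x0.
have -> : x `^ s = x `^ (s - 1) * x.
  by rewrite -[X in _ * X]powRr1 ?(ltW x0)// -powRD ?(gt_eqF x0) ?implybT// subrK.
rewrite /env mulrCA [leRHS]mulrCA ler_wpM2l ?powR_ge0//.
have hM := phiM x; have n0 := normr_ge0 (phi x).
have [x1|x1] := leP x 1; last first.
  rewrite mulr1; have [xA|xA] := leP x A.
    by rewrite ler_pM// ltW.
  by rewrite phiA// normr0 mul0r mulr_ge0 ?(ltW M_gt0)// (le_trans _ A_ge1).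
rewrite ler_wpM2r ?(ltW x0)// (le_trans hM)// ler_peMr// ltW//.
Qed.

Lemma integrable_phi : mu.-integrable HL (EFin \o phi).
Proof.
have A0 : 0 < A by exact: lt_le_trans A_ge1.
(* For 0 < x <= A one has 1 <= A x^(-1/2), so the envelope at s = -1/2 dominates [phi]. *)
have h : mu.-integrable HL (EFin \o (fun x => A * (M * A * env (- 2^-1) x))).
  by do 2![apply: RintegrableZl => //]; apply: integrable_env; lra.
apply: le_Rintegrable h => //.
  by apply: measurable_oy => x _; exact: cphi.
move=> x /HL_gt0 x0.
apply: le_trans (ler_wpM2l (ltW A0) (phi_powR_le_env _ x0)).
have [xA|xA] := ltP A x; first by rewrite phiA// normr0 mul0r mulr0.
rewrite mulrCA ler_peMr// powRN ler_pdivlMr ?powR_gt0// mul1r.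
have [x1|x1] := leP 1 x.
  by rewrite (le_trans _ xA)// ler1_powR//; lra.
rewrite (le_trans _ A_ge1)// -[leRHS](powRr0 x).
by apply: ger_powR; [rewrite x0 ltW|rewrite invr_ge0].
Qed.

Definition osc c t := \int[mu]_(x in HL) (c (t * (1 / x `^ alpha)) * phi x).

Lemma continuous_osc c t x : continuous c -> 0 < x ->
  {for x, continuous (fun x => c (t * (1 / x `^ alpha)) * phi x)}.
Proof.
move=> cc x0; apply: continuousM; last exact: cphi.
apply: (@continuous_comp _ _ _ (fun x => t * (1 / x `^ alpha)) c); last exact: cc.
apply: continuousM; first exact: cvg_cst.
apply: continuousM; first exact: cvg_cst.
by apply: continuousV; [rewrite gt_eqF ?powR_gt0|exact: continuous_powR].
Qed.

Lemma integrable_osc c t (K : R) : continuous c -> (forall z, `|c z| <= K) ->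
  mu.-integrable HL (EFin \o (fun x => c (t * (1 / x `^ alpha)) * phi x)).
Proof.
move=> cc cK.
have h : mu.-integrable HL (EFin \o (fun x => K * `|phi x|)).
  by apply: RintegrableZl => //; exact: integrable_norm integrable_phi.
apply: le_Rintegrable h => //.
  by apply: measurable_oy => x; exact: continuous_osc.
by move=> x _; rewrite normrM ler_wpM2r.
Qed.

Lemma I_tildeE t :
  I_tilde alpha phi t = osc (fun z => cos z - 1) t +i* osc sin t.
Proof.
rewrite /I_tilde /I_osc /cintegral.
have -> : \int[mu]_(x in HL) complex.Re
    (cexp ('i%C * t%:C * (1 / x `^ alpha)%:C) * (phi x)%:C) =
    osc (fun z => cos z - 1) t + \int[mu]_(x in HL) phi x.
  rewrite -RintegralD//; last 2 first.
  - exact: (@integrable_osc (fun z => cos z - 1) t 2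
      (@continuous_cosB1 R) (@norm_cosB1_le2 R)).
  - exact: integrable_phi.
  by apply: eq_Rintegral => x _; rewrite cexp_i /=; ring.
have -> : \int[mu]_(x in HL) complex.Im
    (cexp ('i%C * t%:C * (1 / x `^ alpha)%:C) * (phi x)%:C) = osc sin t.
  by apply: eq_Rintegral => x _; rewrite cexp_i.
by simpc; rewrite addrK.
Qed.

(* For alpha < 1 the factor 1 / x^alpha is integrable against phi, so that
   c (t / x^alpha) / t may be replaced by its limit c'(0) / x^alpha. *)
Lemma cvg_osc_lt1 c (l : R) : alpha < 1 -> continuous c -> (forall z, `|c z| <= `|z|) ->
  is_derive (0 : R) 1 c l ->
  osc c t / t @[t --> 0^'] --> l * \int[mu]_(x in HL) (phi x / x `^ alpha).
Proof.
move=> alpha1 cc cz [dc dcl].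
have c0 : c 0 = 0 by apply/eqP; rewrite -normr_le0 (le_trans (cz 0))// normr0.
have cl : c h / h @[h --> 0^'] --> l.
  rewrite -dcl /derive; apply: cvg_trans dc; apply: near_eq_cvg; near=> h.
  by rewrite /= c0 subr0 addr0 /GRing.scale/= mulr1 mulrC.
have ienv : mu.-integrable HL (EFin \o (fun x => M * A * env (- alpha) x)).
  by apply: RintegrableZl => //; apply: integrable_env; rewrite ?ltrN2 ?oppr_lt0.
have bnd x : 0 < x -> `|phi x| / x `^ alpha <= M * A * env (- alpha) x.
  by move=> x0; rewrite -powRN; exact: phi_powR_le_env.
have mphi : measurable_fun HL (fun x => phi x / x `^ alpha).
  apply: measurable_oy => x x0; apply: continuousM; first exact: cphi.
  by apply: continuousV; [rewrite gt_eqF ?powR_gt0|exact: continuous_powR].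
have iphi : mu.-integrable HL (EFin \o (fun x => phi x / x `^ alpha)).
  apply: le_Rintegrable ienv => // x /HL_gt0 x0.
  by rewrite normrM normfV (ger0_norm (powR_ge0 _ _)) bnd.
rewrite -RintegralZl//.
apply/cvgr_dnbhsP => u_ [u0 cu].
have iosc t : mu.-integrable HL (EFin \o (fun x => c (t * (1 / x `^ alpha)) * phi x)).
  apply: (@le_Rintegrable _ _ _ mu HL _ _
    (fun x => `|t| * (M * A * env (- alpha) x))) => //.
  - by apply: measurable_oy => x; exact: continuous_osc.
  - move=> x /HL_gt0 x0; rewrite normrM.
    apply: le_trans (ler_wpM2l (normr_ge0 _) (bnd _ x0)).
    rewrite [leRHS]mulrA [leRHS]mulrAC ler_wpM2r// (le_trans (cz _))// normrM mul1r.
    by rewrite normfV (ger0_norm (powR_ge0 _ _)).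
  - exact: RintegrableZl.
rewrite (_ : (fun n => _) = (fun n => \int[mu]_(x in HL)
    ((u_ n)^-1 * (c (u_ n * (1 / x `^ alpha)) * phi x)))); last first.
  by apply/funext => n; rewrite RintegralZl// mulrC.
apply: (@cvg_Rintegral_dominated _ (measurableTypeR R) R mu HL _
    (fun n x => (u_ n)^-1 * (c (u_ n * (1 / x `^ alpha)) * phi x)) _
    (fun x => M * A * env (- alpha) x)) => //.
- move=> n; apply: measurable_oy => x x0; apply: continuousM; first exact: cvg_cst.
  exact: continuous_osc.
- move=> x /HL_gt0 x0; have w0 : x `^ alpha != 0 by rewrite gt_eqF ?powR_gt0.
  have wi0 : 1 / x `^ alpha != 0 by rewrite mul1r invr_eq0.
  (* For fixed x, this is the difference quotient of [c] at u_n / x^alpha, which is nonzero and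
     tends to 0. *)
  have h : c (u_ n * (1 / x `^ alpha)) / (u_ n * (1 / x `^ alpha)) @[n --> \oo] --> l.
    move/cvgr_dnbhsP : cl; apply; split.
      by move=> n; rewrite mulf_neq0.
    rewrite (_ : 0 = 0 * (1 / x `^ alpha)); last by rewrite mul0r.
    by apply: cvgM; [|exact: cvg_cst].
  have h2 : c (u_ n * (1 / x `^ alpha)) / (u_ n * (1 / x `^ alpha)) *
     (phi x / x `^ alpha) @[n --> \oo] --> l * (phi x / x `^ alpha).
    by apply: cvgM; [exact: h|exact: cvg_cst].
  apply: cvg_trans h2; apply: near_eq_cvg; apply: nearW => n.
  by have := u0 n => un0; field; rewrite un0 w0.
(* By |c z| <= |z| the factor u_n cancels, so the bound is independent of n. *)
- move=> n x /HL_gt0 x0; rewrite !normrM normfV.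
  apply: le_trans (bnd _ x0).
  rewrite ler_pdivrMl ?normr_gt0// [leRHS]mulrA [leRHS]mulrAC ler_wpM2r//.
  rewrite (le_trans (cz _))// normrM mul1r normfV.
  by rewrite (ger0_norm (powR_ge0 _ _)).
Unshelve. all: by end_near. Qed.

(* The substitution x = (t / u)^(1 / alpha), i.e. t / x^alpha = u. *)
Lemma osc_subst c t : 1 < alpha -> continuous c -> (forall z, `|c z| <= 2) ->
  (forall u, 0 < u -> `|c u| <= 2 * Num.min u 1) -> 0 < t ->
  osc c t = t `^ (1 / alpha) * (1 / alpha * \int[mu]_(u in HL)
    (c u * u `^ (- (1 / alpha) - 1) * phi (t `^ (1 / alpha) * u `^ (- (1 / alpha))))).
Proof.
move=> alpha1 cc c2 cmin t0.
set k := t `^ (1 / alpha); set s := - (1 / alpha).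
have k0 : 0 < k by rewrite powR_gt0.
have a0 : alpha != 0 by rewrite gt_eqF.
have is0 : 0 < 1 / alpha by rewrite divr_gt0.
have s0 : s < 0 by rewrite oppr_lt0.
have s1 : -1 < s by rewrite ltrN2 ltr_pdivrMr// mul1r.
pose F u : R := k * u `^ s; pose F' u : R := k * (s * u `^ (s - 1)).
have F0 u : 0 < u -> 0 < F u by move=> u0; rewrite mulr_gt0 ?powR_gt0.
have dF u : 0 < u -> is_derive u 1 F (F' u).
  by move=> u0; apply: is_deriveZR; exact: is_derive1_powR.
have cF u : 0 < u -> {for u, continuous F}.
  by move=> u0; exact: is_derive_continuous (dF u u0).
have cF' u : 0 < u -> {for u, continuous F'}.
  move=> u0; apply: continuousM; first exact: cvg_cst.
  by apply: continuousM; [exact: cvg_cst|exact: continuous_powR].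
have GF u : 0 < u -> t * (1 / (F u) `^ alpha) = u.
  move=> u0; rewrite /F powRM ?powR_ge0// -!powRrM /s.
  rewrite mulNr -mulrA mulVf// mulr1 powRN !powRr1 ?ltW//.
  by field; rewrite !gt_eqF.
(* The transformed integrand is k / alpha times [H], since - F'(u) = (k / alpha) u^(s - 1). *)
pose H u := c u * u `^ (s - 1) * phi (F u).
have cH u : 0 < u -> {for u, continuous H}.
  move=> u0; apply: continuousM.
    by apply: continuousM; [exact: cc|exact: continuous_powR].
  apply: (@continuous_comp _ _ _ F phi); first exact: cF.
  exact: cphi.
have Hi : mu.-integrable HL (EFin \o H).
  have h : mu.-integrable HL (EFin \o (fun u => M * (2 * env s u))).
    by do 2![apply: RintegrableZl => //]; exact: integrable_env.
  apply: le_Rintegrable h => //; first exact: measurable_oy.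
  move=> u /HL_gt0 u0; rewrite normrM mulrC ler_pM// normrM.
  rewrite (ger0_norm (powR_ge0 _ _)) /env mulrCA mulrC ler_wpM2l ?powR_ge0//.
  exact: cmin.
rewrite /osc (@Rintegration_by_substitution_decreasing_oy R F F').
- rewrite -!RintegralZl//; last exact: RintegrableZl.
  apply: eq_Rintegral => u; rewrite inE => /HL_gt0 u0.
  by rewrite GF// /F' /H -/(F u) /s; ring.
- exact: F0.
- move=> x y x0 xy; rewrite /F ltr_pM2l// /s !powRN ltf_pV2 ?posrE ?powR_gt0//.
    by apply: gt0_ltr_powR; rewrite ?nnegrE ?ltW// (lt_trans x0).
  exact: lt_trans x0 xy.
- exact: cF'.
- have := powR_cvg_at_right_lt0 s0; rewrite /F => h.
  apply/cvgryPge => B; near=> u.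
  rewrite mulrC -ler_pdivrMr//; near: u.
  by move/cvgryPge : h; exact.
- rewrite (_ : 0 = k * 0); last by rewrite mulr0.
  by apply: cvgM; [exact: cvg_cst|exact: powR_cvg_pinfty_lt0].
- by move=> x x0; exact: continuous_osc.
- exact: integrable_osc cc c2.
- have : mu.-integrable HL (EFin \o (fun u => k / alpha * H u)) by exact: RintegrableZl.
  apply: eq_integrable => // u; rewrite inE => /HL_gt0 u0.
  by rewrite /= GF// /F' /H /s; congr EFin; ring.
Unshelve. all: by end_near. Qed.

(** After the substitution t occurs only inside [phi], so M times the envelope dominates for every
    t; alpha > 1 places s = - 1/alpha above -1. *)
Lemma cvg_osc_gt1 c : 1 < alpha -> continuous c -> (forall z, `|c z| <= 2) ->
  (forall u, 0 < u -> `|c u| <= 2 * Num.min u 1) ->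
  osc c t / t `^ (1 / alpha) @[t --> 0^'+] -->
    1 / alpha * (phi 0 * \int[mu]_(u in HL) (c u * u `^ (- (1 / alpha) - 1))).
Proof.
move=> alpha1 cc c2 cmin.
have is0 : 0 < 1 / alpha by rewrite divr_gt0.
set s := - (1 / alpha).
have s0 : s < 0 by rewrite oppr_lt0.
have s1 : -1 < s by rewrite ltrN2 ltr_pdivrMr// mul1r.
have h : mu.-integrable HL (EFin \o (fun u => M * (2 * env s u))).
  by do 2![apply: RintegrableZl => //]; exact: integrable_env.
have cb u : 0 < u -> `|c u * u `^ (s - 1)| <= 2 * env s u.
  move=> u0; rewrite normrM (ger0_norm (powR_ge0 _ _)) /env mulrCA mulrC.
  by rewrite ler_wpM2l ?powR_ge0//; exact: cmin.
have ccs u : 0 < u -> {for u, continuous (fun u => c u * u `^ (s - 1))}.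
  by move=> u0; apply: continuousM; [exact: cc|exact: continuous_powR].
have ic : mu.-integrable HL (EFin \o (fun u => c u * u `^ (s - 1))).
  have h2 : mu.-integrable HL (EFin \o (fun u => 2 * env s u)).
    by apply: RintegrableZl => //; exact: integrable_env.
  apply: le_Rintegrable h2 => //; first exact: measurable_oy.
  by move=> u /HL_gt0; exact: cb.
apply/cvg_at_rightP => t_ [t0 ct].
have ck : t_ n `^ (1 / alpha) @[n --> \oo] --> 0.
  by move/cvg_at_rightP : (powR_cvg0 is0); exact.
rewrite (_ : (fun n => _) = (fun n => 1 / alpha * \int[mu]_(u in HL)
    (c u * u `^ (s - 1) * phi (t_ n `^ (1 / alpha) * u `^ s)))); last first.
  apply/funext => n; rewrite osc_subst// mulrC mulKf//.
  by rewrite gt_eqF ?powR_gt0.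
apply: cvgM; first exact: cvg_cst.
rewrite -RintegralZl//.
have lim_phi u : c u * u `^ (s - 1) * phi (t_ n `^ (1 / alpha) * u `^ s) @[n --> \oo]
    --> c u * u `^ (s - 1) * phi 0.
  apply: cvgM; first exact: cvg_cst.
  apply: (cvg_comp (fun n => t_ n `^ (1 / alpha) * u `^ s) phi); last exact: cphi.
  rewrite (_ : 0 = 0 * u `^ s :> R); last by rewrite mul0r.
  by apply: cvgM; [exact: ck|exact: cvg_cst].
apply: (@cvg_Rintegral_dominated _ (measurableTypeR R) R mu HL _
  (fun n u => c u * u `^ (s - 1) * phi (t_ n `^ (1 / alpha) * u `^ s)) _
  (fun u => M * (2 * env s u))) => //.
- move=> n; apply: measurable_oy => u u0; apply: continuousM; first exact: ccs.
  apply: (@continuous_comp _ _ _ (fun u => t_ n `^ (1 / alpha) * u `^ s) phi).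
    by apply: continuousM; [exact: cvg_cst|exact: continuous_powR].
  exact: cphi.
- by move=> u _; rewrite [phi 0 * _]mulrC; exact: lim_phi.
- by move=> n u /HL_gt0 u0; rewrite normrM mulrC ler_pM// cb.
Qed.

End Oscillatory.

(** * The case alpha = 1: explicit kernels *)

Section Critical.
Variable R : realType.
Local Notation mu := (@lebesgue_measure R).
Local Notation HL := (`]0%R, +oo[%classic : set R).
Implicit Types (t x y : R).

(* This is z^2 / (1 + z^2) for z = t / x, which is comparable to min(1, z^2). *)
Definition cauchy_kernel t x : R := t ^+ 2 / (t ^+ 2 + x ^+ 2).

Lemma sqrDsqr_gt0 t x : 0 < t -> 0 < t ^+ 2 + x ^+ 2.
Proof. by move=> t0; rewrite ltr_pwDl ?sqr_ge0// exprn_gt0. Qed.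

Lemma cauchy_kernel_ge0 t x : 0 < t -> 0 <= cauchy_kernel t x.
Proof. by move=> t0; rewrite divr_ge0 ?sqr_ge0// ltW// sqrDsqr_gt0. Qed.

Lemma is_derive_sqr x : is_derive x 1 (fun y : R => y ^+ 2) (2 * x).
Proof.
apply: (is_derive_eq (is_deriveMR (is_derive_id x 1) (is_derive_id x 1))).
by rewrite mul1r mulr1; ring.
Qed.

Lemma is_derive_sqrDsqr t x : is_derive x 1 (fun y => t ^+ 2 + y ^+ 2) (2 * x).
Proof.
apply: is_derive_eq (is_deriveD (is_derive_cst (t ^+ 2) x 1) (is_derive_sqr x)) _.
by rewrite add0r.
Qed.

Lemma continuous_sqrDsqrV t x : 0 < t ->
  {for x, continuous (fun y => (t ^+ 2 + y ^+ 2)^-1)}.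
Proof.
move=> t0; apply: continuousV; first by rewrite gt_eqF ?sqrDsqr_gt0.
exact: is_derive_continuous (is_derive_sqrDsqr t x).
Qed.

Lemma continuous_cauchy_kernel t x : 0 < t -> {for x, continuous (cauchy_kernel t)}.
Proof.
by move=> t0; apply: continuousM; [exact: cvg_cst|exact: continuous_sqrDsqrV].
Qed.

Lemma is_derive_cauchy_kernel t x : 0 < t ->
  is_derive x 1 (fun y => t * atan (t^-1 * y)) (cauchy_kernel t x).
Proof.
move=> t0.
have d := is_deriveZR t^-1 (is_derive_id x 1).
apply: (is_derive_eq (is_deriveZR t (is_derive_compR (is_derive1_atan _) d))).
rewrite /cauchy_kernel mulr1; field.
by rewrite (gt_eqF t0) /= gt_eqF ?sqrDsqr_gt0.
Qed.

Lemma integrable_cauchy_kernel t : 0 < t ->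
  mu.-integrable HL (EFin \o cauchy_kernel t).
Proof.
move=> t0; apply: (@integrable_oy R (cauchy_kernel t)
  (fun y => t * atan (t^-1 * y)) (t * (pi / 2))).
- by move=> x _; exact: cauchy_kernel_ge0.
- by move=> x _; exact: continuous_cauchy_kernel.
- by move=> x _; exact: is_derive_cauchy_kernel.
- move=> x _; rewrite normrM (gtr0_norm t0) ler_pM2l// ler_norml.
  by rewrite (ltW (atan_gtNpi2 _)) (ltW (atan_ltpi2 _)).
Qed.

Lemma Rintegral_cauchy_kernel t : 0 < t ->
  \int[mu]_(x in HL) cauchy_kernel t x = t * (pi / 2).
Proof.
move=> t0; have dF x (_ : 0 < x) := is_derive_cauchy_kernel x t0.
rewrite (@ftc_oy R (cauchy_kernel t) (fun y => t * atan (t^-1 * y)) 0 (t * (pi / 2))).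
- by rewrite subr0.
- by move=> x _; exact: continuous_cauchy_kernel.
- exact: integrable_cauchy_kernel.
- have := is_derive_continuous (is_derive_cauchy_kernel 0 t0).
  by rewrite /prop_for /continuous_at mulr0 atan0 mulr0; exact: cvg_at_right_filter.
- apply: cvgM; first exact: cvg_cst.
  apply: (cvg_comp (fun y => t^-1 * y) atan); last exact: cvgy_atan.
  by apply/cvgryPge => B; near=> y; rewrite mulrC ler_pdivlMr.
Unshelve. all: by end_near. Qed.

(* Up to O(t), sin (t / x) behaves like t x / (t^2 + x^2) near 0; subtracting
   t x / (1 + x^2) makes it integrable at infinity, with integral - t ln t. *)
Definition log_kernel t x : R := t * x / (t ^+ 2 + x ^+ 2) - t * x / (1 + x ^+ 2).

(** Over a common denominator the kernel is visibly nonnegative for x > 0 and t < 1, with decay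
    x^(-3). *)
Lemma log_kernelE t x : 0 < t -> log_kernel t x =
  t * x * (1 - t ^+ 2) / ((t ^+ 2 + x ^+ 2) * (1 + x ^+ 2)).
Proof.
move=> t0; rewrite /log_kernel; field.
by rewrite !gt_eqF ?sqrDsqr_gt0// ltr_pwDl ?sqr_ge0.
Qed.

(** It equals t ln t at x = 0 and tends to 0 at infinity. *)
Definition log_primitive t x : R := t / 2 * (ln (t ^+ 2 + x ^+ 2) - ln (1 + x ^+ 2)).

Lemma is_derive_log_kernel t x : 0 < t ->
  is_derive x 1 (log_primitive t) (log_kernel t x).
Proof.
move=> t0.
have dln (a : R) : 0 < a -> is_derive x 1 (fun y => ln (a ^+ 2 + y ^+ 2))
    ((a ^+ 2 + x ^+ 2)^-1 * (2 * x)).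
  move=> a0; apply: (@is_derive_compR _ _ (fun y => a ^+ 2 + y ^+ 2)).
    exact: is_derive1_ln (sqrDsqr_gt0 x a0).
  exact: is_derive_sqrDsqr.
have d1 := dln t t0; have d2 := dln 1 ltr01; rewrite expr1n in d2.
apply: (is_derive_eq (is_deriveZR (t / 2) (is_deriveB d1 d2))).
by rewrite /log_kernel; field; rewrite !gt_eqF ?sqrDsqr_gt0// ltr_pwDl ?sqr_ge0.
Qed.

Lemma continuous_log_kernel t x : 0 < t -> {for x, continuous (log_kernel t)}.
Proof.
move=> t0; apply: continuousB.
  apply: continuousM; last exact: continuous_sqrDsqrV.
  by apply: continuousM; [exact: cvg_cst|exact: cvg_id].
apply: continuousM.
  by apply: continuousM; [exact: cvg_cst|exact: cvg_id].
by have := @continuous_sqrDsqrV 1 x ltr01; rewrite expr1n.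
Qed.

(** This is t^2 (1 + x^2) <= t^2 + x^2 <= 1 + x^2 after taking logarithms. *)
Lemma log_primitive_bounds t x : 0 < t -> t < 1 -> t * ln t <= log_primitive t x <= 0.
Proof.
move=> t0 t1; have p1 := sqrDsqr_gt0 x t0.
have p2 : 0 < 1 + x ^+ 2 by rewrite ltr_pwDl ?sqr_ge0.
have t2 : 0 < t / 2 by rewrite divr_gt0.
have tt : t ^+ 2 < 1 by nra.
have x2 := sqr_ge0 x.
apply/andP; split; last first.
  by rewrite pmulr_rle0// subr_le0 ler_ln ?posrE//; lra.
have -> : t * ln t = t / 2 * (ln (t ^+ 2)) by rewrite expr2 lnM ?posrE//; field.
rewrite ler_pM2l// lerBrDr -lnM ?posrE ?exprn_gt0//.
by rewrite ler_ln ?posrE ?mulr_gt0 ?exprn_gt0//; nra.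
Qed.

Lemma integrable_log_kernel t : 0 < t -> t < 1 ->
  mu.-integrable HL (EFin \o log_kernel t).
Proof.
move=> t0 t1; apply: (@integrable_oy R (log_kernel t) (log_primitive t) (- (t * ln t))).
- move=> x x0; rewrite log_kernelE// divr_ge0 ?mulr_ge0 ?(ltW t0) ?(ltW x0)//.
  + by nra.
  + by rewrite ltW// sqrDsqr_gt0.
  + by rewrite ltW// ltr_pwDl ?sqr_ge0.
- by move=> x _; exact: continuous_log_kernel.
- by move=> x _; exact: is_derive_log_kernel.
- move=> x _; have /andP[l1 l2] := log_primitive_bounds x t0 t1.
  by rewrite ler0_norm// lerN2.
Qed.

Lemma Rintegral_log_kernel t : 0 < t -> t < 1 ->
  \int[mu]_(x in HL) log_kernel t x = - (t * ln t).
Proof.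
move=> t0 t1; have dF x (_ : 0 < x) := is_derive_log_kernel x t0.
rewrite (@ftc_oy R (log_kernel t) (log_primitive t) (t * ln t) 0) ?sub0r//.
- by move=> x _; exact: continuous_log_kernel.
- exact: integrable_log_kernel.
- have := is_derive_continuous (is_derive_log_kernel 0 t0).
  rewrite /prop_for /continuous_at {2}/log_primitive expr0n/= !addr0 ln1 subr0.
  have -> : t / 2 * (ln (t ^+ 2)) = t * ln t by rewrite expr2 lnM ?posrE//; field.
  exact: cvg_at_right_filter.
(* The lower function of the squeeze comes from ln(1 + y) <= y at y = (1 - t^2) / (t^2 + x^2), which
   is at most 1/x. *)
- have h : - (t / 2 * x^-1) @[x --> +oo] --> - (t / 2 * (0 : R)).
    apply: cvgN; apply: cvgM; first exact: cvg_cst.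
    apply/gtr0_cvgV0; last exact: cvg_id.
    by apply: nbhs_pinfty_gt; rewrite num_real.
  rewrite mulr0 oppr0 in h; apply: (squeeze_cvgr _ h (cvg_cst 0)).
  near=> x; have x1 : 1 <= x by near: x; apply: nbhs_pinfty_ge; rewrite num_real.
  have /andP[_ ->] := log_primitive_bounds x t0 t1; rewrite andbT.
  have x0 : 0 < x by exact: lt_le_trans x1.
  have p1 := sqrDsqr_gt0 x t0.
  have p2 : 0 < 1 + x ^+ 2 by rewrite ltr_pwDl ?sqr_ge0.
  rewrite /log_primitive -mulrN ler_pM2l ?divr_gt0// lerNl opprB -ln_div ?posrE//.
  have -> : (1 + x ^+ 2) / (t ^+ 2 + x ^+ 2) = 1 + (1 - t ^+ 2) / (t ^+ 2 + x ^+ 2).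
    by field; rewrite gt_eqF.
  have t2 : t ^+ 2 < 1 by nra.
  have q : 0 <= (1 - t ^+ 2) / (t ^+ 2 + x ^+ 2) by rewrite divr_ge0//; lra.
  rewrite (le_trans (le_ln1Dx _))//; first by lra.
  rewrite ler_pdivrMr// mulrC ler_pdivlMr//; nra.
Unshelve. all: by end_near. Qed.

Variables (phi : R -> R) (M A L : R).
Hypothesis cphi : continuous phi.
Hypotheses (M_gt0 : 0 < M) (A_ge1 : 1 <= A).
Hypotheses (phiM : forall x, `|phi x| <= M) (phiA : forall x, A < x -> phi x = 0).
Hypothesis phiL : forall x, 0 < x -> `|phi x - phi 0| <= L * x.

Let tovx t x : 0 < x -> t * (1 / x `^ 1) = t / x.
Proof. by move=> x0; rewrite powRr1 ?mul1r// ltW. Qed.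

Let ratE t x : 0 < t -> 0 < x ->
  (t / x) ^+ 2 / (1 + (t / x) ^+ 2) = cauchy_kernel t x.
Proof.
move=> t0 x0; rewrite /cauchy_kernel; field.
by rewrite !gt_eqF ?sqrDsqr_gt0// addrC sqrDsqr_gt0.
Qed.

Lemma osc_cos_critical t : 0 < t ->
  `|osc 1 phi (fun z => cos z - 1) t| <= 4 * M * (pi / 2) * t.
Proof.
move=> t0.
have io := @integrable_osc R 1 phi M A cphi M_gt0 A_ge1 phiM phiA
  (fun z => cos z - 1) t 2 (@continuous_cosB1 R) (@norm_cosB1_le2 R).
rewrite /osc (le_trans (le_normr_Rintegral _ io))//.
apply: (@le_trans _ _ (\int[mu]_(x in HL) (4 * M * cauchy_kernel t x))).
  apply: le_Rintegral => //.
  - exact: integrable_norm io.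
  - by apply: RintegrableZl => //; exact: integrable_cauchy_kernel.
  - move=> x /HL_gt0 x0; rewrite tovx// normrM mulrAC ler_pM// -ratE//.
    by rewrite norm_cosB1_le_rat// divr_gt0.
rewrite RintegralZl//; last exact: integrable_cauchy_kernel.
by rewrite Rintegral_cauchy_kernel// mulrCA mulrC mulrA.
Qed.

(** The first term on the right has integral O(t) because the kernel does; the second has an
    explicit factor t and a fixed integrable function, [cauchy_kernel 1 x] being 1 / (1 + x^2). *)
Lemma osc_sin_bound t x : 0 < t -> t < 1 -> 0 < x ->
  `|sin (t * (1 / x `^ 1)) * phi x - phi 0 * log_kernel t x| <=
  3 * M * cauchy_kernel t x + t * (2 * (L + M) * cauchy_kernel 1 x + `|phi x|).
Proof.
move=> t0 t1 x0; rewrite tovx//.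
have L0 : 0 <= L by have := phiL ltr01; rewrite mulr1; apply: le_trans.
have z0 : 0 < t / x by rewrite divr_gt0.
have p1 : 0 < t ^+ 2 + x ^+ 2 := sqrDsqr_gt0 x t0.
have p2 : 0 < 1 + x ^+ 2 by rewrite ltr_pwDl ?sqr_ge0.
have k1 : cauchy_kernel 1 x = (1 + x ^+ 2)^-1 by rewrite /cauchy_kernel expr1n mul1r.
have ck0 := cauchy_kernel_ge0 x t0.
have [x1|x1] := leP x 1.
  (* Three errors: sin against its rational substitute, phi(x) against phi(0), controlled by the
     Lipschitz bound, and the correction t x / (1 + x^2). On x <= 1 the factor 2 / (1 + x^2) is at
     least 1. *)
  have -> : sin (t / x) * phi x - phi 0 * log_kernel t x =
      (sin (t / x) - t / x / (1 + (t / x) ^+ 2)) * phi x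
      + (t * x / (t ^+ 2 + x ^+ 2) * (phi x - phi 0)
      + t * (x / (1 + x ^+ 2) * phi 0)).
    have -> : t / x / (1 + (t / x) ^+ 2) = t * x / (t ^+ 2 + x ^+ 2).
      by field; rewrite !gt_eqF// addrC.
    by rewrite /log_kernel; ring.
  apply: le_trans (ler_normD _ _) _; apply: lerD.
    rewrite normrM [leRHS]mulrAC ler_pM//.
    by rewrite -ratE// norm_sinB_le_rat.
  rewrite (@le_trans _ _ (t * (2 * (L + M) * cauchy_kernel 1 x)))//; last first.
    by rewrite ler_pM2l// lerDl.
  apply: le_trans (ler_normD _ _) _.
  rewrite [X in _ <= t * (X * _)]mulrDr mulrDl mulrDr lerD//.
    rewrite normrM !normrM normfV (gtr0_norm t0) (gtr0_norm x0) (gtr0_norm p1).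
    apply: (@le_trans _ _ (t * x / (t ^+ 2 + x ^+ 2) * (L * x))).
      by rewrite ler_wpM2l ?phiL// divr_ge0 ?mulr_ge0// ltW.
    have -> : t * x / (t ^+ 2 + x ^+ 2) * (L * x) =
      t * (L * (x ^+ 2 / (t ^+ 2 + x ^+ 2))) by field; rewrite gt_eqF.
    rewrite ler_pM2l// k1 -[2 * L * _]mulrA [leRHS]mulrCA ler_wpM2l//.
    apply: (@le_trans _ _ 1).
      by rewrite ler_pdivrMr// mul1r lerDr sqr_ge0.
    by rewrite ler_pdivlMr//; nra.
  rewrite !normrM normfV (gtr0_norm t0) (gtr0_norm x0) (gtr0_norm p2).
  rewrite ler_pM2l// mulrC mulrA k1 ler_pM2r ?invr_gt0//.
  by have := phiM 0; have := normr_ge0 (phi 0); nra.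
(* Beyond 1 no cancellation is sought: the sine is at most t, and the kernel at most t / (1 +
   x^2). *)
have xi : t / x <= t by rewrite ler_pdivrMr// ler_peMr// ltW.
apply: le_trans (ler_normB _ _) _.
rewrite -[leLHS]add0r; apply: lerD.
  by do 2![apply: mulr_ge0 => //]; exact: ltW.
rewrite [leRHS]mulrDr [leLHS]addrC; apply: lerD; last first.
  rewrite normrM ler_wpM2r// (le_trans (norm_sin_le (ltW z0)))//.
rewrite normrM log_kernelE// k1 mulrCA.
have lk0 : 0 <= t * x * (1 - t ^+ 2) / ((t ^+ 2 + x ^+ 2) * (1 + x ^+ 2)).
  rewrite divr_ge0 ?mulr_ge0 ?(ltW t0) ?(ltW x0) ?(ltW p1) ?(ltW p2)//; nra.
rewrite (ger0_norm lk0).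
apply: (@le_trans _ _ (M * (t / (1 + x ^+ 2)))).
  apply: ler_pM => //.
  rewrite ler_pdivrMr ?mulr_gt0//.
  have -> : t / (1 + x ^+ 2) * ((t ^+ 2 + x ^+ 2) * (1 + x ^+ 2)) =
    t * (t ^+ 2 + x ^+ 2) by field; rewrite gt_eqF.
  by rewrite -mulrA ler_pM2l//; nra.
apply: ler_wpM2r; first by rewrite divr_ge0 ?ltW.
by have := ltW M_gt0; lra.
Qed.

Lemma osc_sin_critical : exists C, forall t, 0 < t -> t < 1 ->
  `|osc 1 phi sin t - phi 0 * - (t * ln t)| <= C * t.
Proof.
(* The integral of the pointwise bound, divided by t. *)
exists (3 * M * (pi / 2) + (2 * (L + M) * (pi / 2) + \int[mu]_(x in HL) `|phi x|)).
move=> t t0 t1.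
have io := @integrable_osc R 1 phi M A cphi M_gt0 A_ge1 phiM phiA
  sin t 1 (@continuous_sin R) (@sin_max R).
have ik := integrable_log_kernel t0 t1.
have inphi : mu.-integrable HL (EFin \o (fun x => `|phi x|)).
  exact: integrable_norm (integrable_phi cphi M_gt0 A_ge1 phiM phiA).
have ic1 : mu.-integrable HL (EFin \o (fun x => 2 * (L + M) * cauchy_kernel 1 x)).
  by apply: RintegrableZl => //; exact: integrable_cauchy_kernel.
have ict : mu.-integrable HL (EFin \o (fun x => 3 * M * cauchy_kernel t x)).
  by apply: RintegrableZl => //; exact: integrable_cauchy_kernel.
have ib : mu.-integrable HL
    (EFin \o (fun x => 2 * (L + M) * cauchy_kernel 1 x + `|phi x|)).
  exact: RintegrableD.
have idiff : mu.-integrable HL (EFin \o (fun x =>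
    sin (t * (1 / x `^ 1)) * phi x - phi 0 * log_kernel t x)).
  have : mu.-integrable HL (EFin \o (fun x =>
      sin (t * (1 / x `^ 1)) * phi x + - phi 0 * log_kernel t x)).
    by apply: RintegrableD => //; exact: RintegrableZl.
  by apply: eq_integrable => // x _; rewrite /= mulNr.
have -> : osc 1 phi sin t - phi 0 * - (t * ln t) = \int[mu]_(x in HL)
    (sin (t * (1 / x `^ 1)) * phi x - phi 0 * log_kernel t x).
  rewrite RintegralB//; last exact: RintegrableZl.
  by rewrite RintegralZl// Rintegral_log_kernel.
rewrite (le_trans (le_normr_Rintegral _ idiff))//.
apply: (@le_trans _ _ (\int[mu]_(x in HL) (3 * M * cauchy_kernel t x +
    t * (2 * (L + M) * cauchy_kernel 1 x + `|phi x|)))).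
  apply: le_Rintegral => //.
  - exact: integrable_norm idiff.
  - by apply: RintegrableD => //; exact: RintegrableZl.
  - by move=> x /HL_gt0 x0; exact: osc_sin_bound.
have intK (c a : R) : 0 < a ->
    \int[mu]_(x in HL) (c * cauchy_kernel a x) = c * (a * (pi / 2)).
  move=> a0; rewrite RintegralZl//; last exact: integrable_cauchy_kernel.
  by rewrite Rintegral_cauchy_kernel.
rewrite RintegralD//; last exact: RintegrableZl.
rewrite (RintegralZl t _ ib)// RintegralD// !intK//.
by rewrite le_eqVlt; apply/orP; left; apply/eqP; ring.
Qed.

End Critical.

(** * From an O(t) error to the limit on the scale t ln t *)

Section LogScale.
Variable R : realType.

Lemma cvg_log_scale (g : R -> R) (l C : R) :
  (forall t, 0 < t -> t < 1 -> `|g t - l * (t * ln t)| <= C * t) ->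
  g t / (t * ln t) @[t --> 0^'+] --> l.
Proof.
move=> hg; apply/cvgrPdist_le => e e0; near=> t.
have t0 : 0 < t by [].
have t1 : t < 1 by near: t; exact: nbhs_right_lt.
(* After division by t |ln t| the error is at most |C| / |ln t|, which this makes smaller than e. *)
have lt0 : ln t < - (`|C| / e).
  by near: t; have /cvgrNyPlt := @lnNy R; exact.
have ln0 : ln t < 0 by rewrite (lt_le_trans lt0)// oppr_le0 divr_ge0// ltW.
have tl : t * ln t != 0 by rewrite mulf_neq0 ?(gt_eqF t0) ?(lt_eqF ln0).
have -> : l - g t / (t * ln t) = - ((g t - l * (t * ln t)) / (t * ln t)).
  by field; rewrite (gt_eqF t0) (lt_eqF ln0).
rewrite normrN normrM normfV (ler_pdivrMr _ _ _) ?normr_gt0//.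
rewrite (le_trans (hg _ t0 t1))// normrM (gtr0_norm t0) (ltr0_norm ln0) mulrCA mulrC.
rewrite ler_pM2l// (le_trans (ler_norm _))//.
move: lt0; rewrite ltrNr ltr_pdivrMr// => /ltW; rewrite mulrC; apply.
Unshelve. all: by end_near. Qed.

End LogScale.

(** * The Gamma factor and real divisors *)

Section GammaValue.
Variable R : realType.
Local Notation mu := (@lebesgue_measure R).
Local Notation HL := (`]0%R, +oo[%classic : set R).

Lemma cexp_real (x : R) : cexp x%:C = (expR x)%:C.
Proof. by rewrite /cexp /= cos0 sin0; simpc. Qed.

(** One unit shift suffices here, so Gamma(s) is Euler's integral at s + 1 divided by s, and
    [int_re0] identifies that integral with s times [int_re s 0]. *)
Lemma Gamma_neg (s : R) : -1 < s -> s < 0 ->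
  Gamma s%:C = (int_re s 0)%:C.
Proof.
move=> s1 s0; have sn0 : s != 0 by rewrite lt_eqF.
rewrite /Gamma /Gamma_shift /= ltNge (ltW s0) /=.
have -> : Num.truncn (- s) = 0%N.
  by apply/eqP; rewrite -leqn0 truncn_le_nat; lra.
rewrite big_ord_recl big_ord0 mulr1 addr0.
have h : Gamma_integral (s%:C + 1%:R) = (s * int_re s 0)%:C.
  rewrite int_re0// /Gamma_integral /cintegral.
  have e x : HL x -> cexp ((s%:C + 1%:R - 1) * (ln x)%:C) * (expR (- x))%:C =
      (x `^ s * expR (- x))%:C.
    move=> /HL_gt0 x0; rewrite addrK -rmorphM cexp_real -rmorphM.
    by rewrite /powR gt_eqF.
  congr (_ +i* _).
    by apply: eq_Rintegral => x; rewrite inE => /e ->.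
  transitivity (\int[mu]_(x in HL) (0 : R)); last by rewrite Rintegral_cst// mul0r.
  by apply: eq_Rintegral => x; rewrite inE => /e ->.
rewrite h rmorphM mulrAC divff ?mul1r//.
by rewrite eq_complex /= negb_and sn0.
Qed.

Lemma rot_re_pihalf (u : R) : rot_re (pi / 2) u = cos u.
Proof. by rewrite /rot_re cos_pihalf sin_pihalf mulr0 oppr0 expR0 mul1r mulr1. Qed.

Lemma rot_im_pihalf (u : R) : rot_im (pi / 2) u = sin u.
Proof. by rewrite /rot_im cos_pihalf sin_pihalf mulr0 oppr0 expR0 mul1r mulr1. Qed.

Lemma complex_div_real (a b d : R) : (a +i* b) / d%:C = (a / d) +i* (b / d).
Proof.
(* With inverse 0 at 0 the identity persists; the quotients are later equated as functions of every
   t, also where the divisor vanishes. *)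
have [->|d0] := eqVneq d 0; first by rewrite !invr0 !mulr0.
by rewrite -fmorphV; simpc.
Qed.

End GammaValue.

Theorem corollary1p4 (R : realType) (alpha : R) (phi : R -> R) (U : set R)
    (alpha_gt0 : 0 < alpha)
    (U_open : open U) (U_itv : is_interval U) (U0 : U 0)
    (phi_smooth : smooth_on U phi)
    (phi_compact : compact (tsupport phi))
    (phi_supp : tsupport phi `<=` U) :
  [/\ alpha < 1 ->
        I_tilde alpha phi t / t%:C @[t --> 0^'] -->
          ('i%C * (\int[lebesgue_measure]_(x in `]0, +oo[)
                   (phi x / x `^ alpha))%:C : R[i]^o),
      alpha = 1 ->
        I_tilde alpha phi t / (t * ln t)%:C @[t --> 0^'+] -->
          (- 'i%C * (phi 0)%:C : R[i]^o)
    & 1 < alpha ->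
        I_tilde alpha phi t / (t `^ (1 / alpha))%:C @[t --> 0^'+] -->
          ((1 / alpha)%:C * (phi 0)%:C
           * cexp (- (1 / (2 * alpha) * pi)%:C * 'i%C)
           * Gamma (- (1 / alpha))%:C : R[i]^o)].
Proof.
have dphi := smooth_supp_derivable phi_smooth phi_supp.
have cphi : continuous phi.
  by move=> x; exact/differentiable_continuous/derivable1_diffP.
have [M [A [M_gt0 A_ge1 phiM phiA]]] := compact_supp_bound phi_compact cphi.
have IE t := I_tildeE alpha cphi M_gt0 A_ge1 phiM phiA t.
have cvgI (F : set_system R) (FF : Filter F) (d : R -> R) (a b : R) (z : R[i]) :
    osc alpha phi (fun z => cos z - 1) t / d t @[t --> F] --> a ->
    osc alpha phi sin t / d t @[t --> F] --> b -> z = a +i* b ->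
    I_tilde alpha phi t / (d t)%:C @[t --> F] --> (z : R[i]^o).
  move=> ha hb ->; rewrite (_ : (fun t => _) = (fun t =>
    (osc alpha phi (fun z => cos z - 1) t / d t) +i* (osc alpha phi sin t / d t))).
    exact: cvg_complex.
  by apply/funext => t; rewrite IE complex_div_real.
have cC := @continuous_cosB1 R; have cS := @continuous_sin R.
split.
- move=> alpha1.
  have dC : is_derive (0 : R) 1 (fun z => cos z - 1) 0.
    apply: is_derive_eq (is_deriveB (is_derive_cos 0) _) _.
    by rewrite sin0 subr0 oppr0.
  have dS : is_derive (0 : R) 1 sin 1.
    by apply: is_derive_eq (is_derive_sin 0) _; rewrite cos0.
  have hc := cvg_osc_lt1 alpha_gt0 cphi M_gt0 A_ge1 phiM phiA alpha1 cC
    (@norm_cosB1_le_norm R) dC.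
  have hs := cvg_osc_lt1 alpha_gt0 cphi M_gt0 A_ge1 phiM phiA alpha1 cS
    (@norm_sin_le_norm R) dS.
  by apply: (cvgI _ _ id _ _ _ hc hs); simpc.
- move=> alpha1; rewrite alpha1 in cvgI *.
  have [L phiL] := derivable_lipschitz0 (dphi 0) phiM.
  have hc := @osc_cos_critical R phi M A cphi M_gt0 A_ge1 phiM phiA.
  have [C hs] := osc_sin_critical cphi M_gt0 A_ge1 phiM phiA phiL.
  (* The cosine part has logarithmic coefficient 0, so the limit is purely imaginary. *)
  apply: (cvgI _ _ (fun t => t * ln t) 0 (- phi 0)); last by simpc.
    apply: cvg_log_scale => t t0 _; rewrite mul0r subr0; exact: hc.
  by apply: cvg_log_scale => t t0 t1; rewrite mulNr -mulrN; exact: hs.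
- move=> alpha1; set s := - (1 / alpha).
  have s0 : s < 0 by rewrite oppr_lt0 divr_gt0.
  have s1 : -1 < s by rewrite ltrN2 ltr_pdivrMr// mul1r.
  (* At th = pi/2 the rotated exponential is e^(i u), so its bounds specialize to cos - 1 and
     sin. *)
  have minC (u : R) : 0 < u -> `|cos u - 1| <= 2 * Num.min u 1.
    move=> u0; rewrite -rot_re_pihalf norm_rot_reB1_le ?cos_pihalf//; exact: ltW.
  have minS (u : R) : 0 < u -> `|sin u| <= 2 * Num.min u 1.
    move=> u0; rewrite -rot_im_pihalf.
    rewrite (le_trans (norm_rot_im_le_min (ltW u0) _)) ?cos_pihalf//.
    by rewrite ler_peMl ?ler1n// le_min ler01 ltW.
  have sin2 (z : R) : `|sin z| <= 2 by rewrite (le_trans (sin_max z))// ler1n.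
  have hc := cvg_osc_gt1 alpha_gt0 cphi M_gt0 A_ge1 phiM phiA alpha1 cC
    (@norm_cosB1_le2 R) minC.
  have hs := cvg_osc_gt1 alpha_gt0 cphi M_gt0 A_ge1 phiM phiA alpha1 cS sin2 minS.
  apply: (cvgI _ _ (fun t => t `^ (1 / alpha)) _ _ _ hc hs).
  rewrite Gamma_neg// -/s.
  have [er ei] := int_re_im_pihalf s1 s0.
  have -> : \int[lebesgue_measure]_(u in `]0%R, +oo[) ((cos u - 1) * u `^ (s - 1)) =
      int_re s 0 * cos (s * (pi / 2)).
    by rewrite -er; apply: eq_Rintegral => u _; rewrite rot_re_pihalf.
  have -> : \int[lebesgue_measure]_(u in `]0%R, +oo[) (sin u * u `^ (s - 1)) =
      int_re s 0 * sin (s * (pi / 2)).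
    by rewrite -ei; apply: eq_Rintegral => u _; rewrite rot_im_pihalf.
  have -> : cexp (- (1 / (2 * alpha) * pi)%:C * 'i%C) =
      cos (s * (pi / 2)) +i* sin (s * (pi / 2)).
    (* The accumulated angle s pi/2 is the phase of the stated limit. *)
    have -> : s * (pi / 2) = - (1 / (2 * alpha) * pi).
      by rewrite /s; field; rewrite gt_eqF.
    by rewrite /cexp /=; simpc; rewrite expR0 !mul1r.
  simpc; congr (_ +i* _); ring.
Qed.
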